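(* Let $n\ge1$, $T>0$, $\alpha\ge0$, $\Lambda$ symmetric positive definite, $\Sigma$ symmetric nonnegative definite, $\theta_1,\dots,\theta_n\ge0$, and for $l>l_0$ let $C(l,\cdot)$ be the unique solution on $(-\infty,T]$ of $C'=C^\top\Lambda^{-1}C+C^\top\tilde CC-\alpha\Sigma$, $C(T)=lI$, $\tilde C=\operatorname{diag}(\theta_i/c_{i,i})$. Let $t\in[0,T)$. (i) The entrywise limit $C(t):=\lim_{l\to\infty}C(l,t)$ exists on $[0,T)$, and $C(l,\cdot)$ converges to $C$ uniformly on compact subsets of $[0,T)$. Furthermore $\lim_{l\to\infty}c_{\min}(l,T)=\infty$, where $c_{\min}(l,T)$ is the smallest eigenvalue of $C(l,T)$. (ii) $C$ solves $C'=C^\top\Lambda^{-1}C+C^\top\tilde CC-\alpha\Sigma$ on $[0,T)$ (with $\tilde C=\operatorname{diag}(\theta_i/c_{i,i})$ built from the entries of $C$), with boundary condition $\lim_{s\to T-}c_{\min}(s)=\infty$, where $c_{\min}(s)$ is the smallest eigenvalue of $C(s)$. Moreover $$0<P(t)\le\sqrt{\Lambda^{-1}}\,C(t)\,\sqrt{\Lambda^{-1}}\le Q(t),$$ where $P(t):=\lim_{l\to\infty}P(l,t)$ and $Q(t):=\lim_{l\to\infty}Q(l,t)$, with $P(l,\cdot),Q(l,\cdot)$ the solutions of $P'=P^2+\theta P-\alpha d_{\min}I$, $P(T)=\frac{l}{\lambda_{\max}}I$, and $Q'=Q^2-\alpha d_{\max}I$, $Q(T)=\frac{l}{\lambda_{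\min}}I$.
   Context: $\theta=\sum_i\theta_i$; $D=\sqrt{\Lambda^{-1}}\Sigma\sqrt{\Lambda^{-1}}$ with smallest/largest eigenvalues $d_{\min},d_{\max}$; $\lambda_{\min},\lambda_{\max}$ the smallest/largest eigenvalues of $\Lambda$; $l_0:=\max\{\lambda_{\max}(\sqrt{\theta^2/4+\alpha d_{\min}}-\theta/2),\ \lambda_{\min}\sqrt{\alpha d_{\max}}\}$. For $l>l_0$ the matrix initial value problem has a unique symmetric solution on $(-\infty,T]$ (so $C(l,t)$ is well defined). For symmetric $A,B$, $A\le B$ means $B-A$ nonnegative definite. $P(l,t)$ and $Q(l,t)$ are scalar multiples of the identity, and their limits as $l\to\infty$ exist for $t<T$. *)

(* Defs.v *)
From HB Require Import structures.
From mathcomp Require Import all_boot all_order all_algebra.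
From mathcomp Require Import all_classical all_reals all_analysis.
Set Implicit Arguments. Unset Strict Implicit. Unset Printing Implicit Defensive.
Import Order.TTheory GRing.Theory Num.Theory.
Import numFieldNormedType.Exports.
Local Open Scope classical_set_scope.
Local Open Scope ring_scope.

Section Defs.
Variable R : realType.
Variable n : nat.

Definition qform (A : 'M[R]_n) (v : 'rV[R]_n) : R := (v *m A *m v^T) 0 0.

Definition sym_mx (A : 'M[R]_n) : Prop := A^T = A.

Definition nonneg_def (A : 'M[R]_n) : Prop :=
  sym_mx A /\ forall v, 0 <= qform A v.

Definition pos_def (A : 'M[R]_n) : Prop :=
  sym_mx A /\ forall v, v != 0 -> 0 < qform A v.

Definition loewner_le (A B : 'M[R]_n) : Prop := nonneg_def (B - A).

Definition eig_min (A : 'M[R]_n) : R :=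
  xget 0 [set d | eigenvalue A d /\ forall e, eigenvalue A e -> d <= e].
Definition eig_max (A : 'M[R]_n) : R :=
  xget 0 [set d | eigenvalue A d /\ forall e, eigenvalue A e -> e <= d].

Definition sqrtm (A : 'M[R]_n) : 'M[R]_n :=
  xget 0 [set S | nonneg_def S /\ S *m S = A].

(* derivative of f at t within the set A (one-sided at endpoints of A) *)
Definition deriv_within (A : set R) (f : R -> R) (t d : R) : Prop :=
  (fun h => h^-1 * (f (t + h) - f t))
    @ within (fun h => h != 0 /\ A (t + h)) (nbhs (0 : R)) --> d.

Definition riccati_rhs (Lam Sig : 'M[R]_n) (alpha : R) (theta : 'I_n -> R)
    (C : 'M[R]_n) : 'M[R]_n :=
  C^T *m invmx Lam *m C
  + C^T *m diag_mx (\row_i (theta i / C i i)) *m C - alpha *: Sig.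

Definition riccati_sol_on (I : set R) (Lam Sig : 'M[R]_n) (alpha : R)
    (theta : 'I_n -> R) (C : R -> 'M[R]_n) : Prop :=
  forall t, I t -> forall i j,
    deriv_within I (fun s => C s i j) t (riccati_rhs Lam Sig alpha theta (C t) i j).

End Defs.

(* Main.v *)
Require Import Defs.
From HB Require Import structures.
From mathcomp Require Import all_boot all_order all_algebra.
From mathcomp Require Import all_classical all_reals all_analysis.
From mathcomp Require Import ring lra zify.
Import Order.TTheory GRing.Theory Num.Theory.
Import numFieldNormedType.Exports.
Local Open Scope classical_set_scope.
Local Open Scope ring_scope.
Set Implicit Arguments. Unset Strict Implicit. Unset Printing Implicit Defensive.

(* Every comparison comes from one exit argument: a curve of symmetric matrices that
   is positive definite at [T] stays so backward in time if, whenever it degenerates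
   to a nonnegative matrix with kernel vector [v], the derivative of its quadratic form
   at [v] is negative. By Cauchy-Schwarz the term [C diag(theta_i / c_ii) C] lies between
   [0] and [theta C], so the argument applies to [C - (1 - e) p Lam], [(1 + e) q Lam - C]
   and [(1 + e) C2 - C1]; dilating by [1 +- e] is what makes the inequalities strict.
   Hence [C(l, .)] is nondecreasing in [l] and, comparing with [k + 1 / (T - t)], bounded
   for [t < T] uniformly in [l]. The equation being autonomous, comparison also yields
   [C(l, t) <= C(l', t) <= C(l, t + s)] for [l <= l'], with [s] depending only on [l] and
   tending to 0. Together with a uniform Lipschitz bound this gives uniform convergence,
   and the mean value inequality passes the equation to the limit. *)

(** * Quadratic forms and symmetric matrices *)

Lemma cvg_sumr (R : realType) (X : Type) (F : set_system X) {FF : Filter F}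
    (I : Type) (r : seq I) (f : I -> X -> R) (l : I -> R) :
  (forall i, f i x @[x --> F] --> l i) ->
  (\sum_(i <- r) f i x) @[x --> F] --> \sum_(i <- r) l i.
Proof.
move=> fl; elim: r => [|i r IH].
  by under eq_cvg do rewrite big_nil; rewrite big_nil; exact: cvg_cst.
by under eq_cvg do rewrite big_cons; rewrite big_cons; apply: cvgD.
Qed.

Section QuadraticForms.
Variables (R : realType) (n : nat).
Implicit Types (A B M : 'M[R]_n) (u v w : 'rV[R]_n).

Definition bform A u v : R := (u *m A *m v^T) 0 0.

Lemma qformE A v : qform A v = \sum_j \sum_i v 0 i * A i j * v 0 j.
Proof.
rewrite /qform mxE; apply: eq_bigr => j _.
by rewrite !mxE mulr_suml; apply: eq_bigr => i _.
Qed.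

Lemma qformD A B v : qform (A + B) v = qform A v + qform B v.
Proof. by rewrite /qform mulmxDr mulmxDl mxE. Qed.

Lemma qformN A v : qform (- A) v = - qform A v.
Proof. by rewrite /qform mulmxN mulNmx mxE. Qed.

Lemma qformB A B v : qform (A - B) v = qform A v - qform B v.
Proof. by rewrite qformD qformN. Qed.

Lemma qformZ a A v : qform (a *: A) v = a * qform A v.
Proof. by rewrite /qform -scalemxAr -scalemxAl mxE. Qed.

Lemma qform_scalevec A a v : qform A (a *: v) = a ^+ 2 * qform A v.
Proof.
by rewrite /qform linearZ /= -scalemxAl -scalemxAr -scalemxAl !mxE expr2 mulrA.
Qed.

Lemma qform0 A : qform A 0 = 0.
Proof. by rewrite /qform !mul0mx mxE. Qed.

Lemma qform_mul A M v : qform A (v *m M) = qform (M *m A *m M^T) v.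
Proof. by rewrite /qform trmx_mul !mulmxA. Qed.

Lemma qform1E v : qform 1%:M v = \sum_i v 0 i ^+ 2.
Proof. by rewrite /qform mulmx1 mxE; apply: eq_bigr => i _; rewrite mxE expr2. Qed.

Lemma qform1_ge0 v : 0 <= qform 1%:M v.
Proof. by rewrite qform1E sumr_ge0 // => i _; exact: sqr_ge0. Qed.

Lemma qform1_eq0 v : (qform 1%:M v == 0) = (v == 0).
Proof.
apply/eqP/eqP => [|->]; last by rewrite qform0.
rewrite qform1E => /eqP; rewrite psumr_eq0 => [/allP h|i _]; last exact: sqr_ge0.
apply/rowP => i; rewrite mxE; apply/eqP.
by have := h i (mem_index_enum i); rewrite sqrf_eq0.
Qed.

Lemma qform1_gt0 v : v != 0 -> 0 < qform 1%:M v.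
Proof. by move=> v0; rewrite lt_def qform1_eq0 v0 qform1_ge0. Qed.

Lemma qform_scalar a v : qform a%:M v = a * qform 1%:M v.
Proof. by rewrite -qformZ scalemx1. Qed.

Lemma qform_scalarB a b v : qform (a%:M - b%:M) v = (a - b) * qform 1%:M v.
Proof. by rewrite qformB (qform_scalar a) (qform_scalar b) mulrBl. Qed.

Lemma pos_def1 : pos_def (1%:M : 'M[R]_n).
Proof. by split; [exact: trmx1 | move=> v; exact: qform1_gt0]. Qed.

Lemma qform_delta A i : qform A (delta_mx 0 i) = A i i.
Proof. by rewrite /qform -rowE trmx_delta -colE !mxE. Qed.

Lemma delta_rV_neq0 i : (delta_mx 0 i : 'rV[R]_n) != 0.
Proof. by apply/eqP => /rowP/(_ i) /eqP; rewrite !mxE !eqxx oner_eq0. Qed.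

Lemma bformC A u v : sym_mx A -> bform A u v = bform A v u.
Proof.
move=> sA; rewrite /bform -[in LHS](trmxK (u *m A *m v^T)) mxE.
by rewrite !trmx_mul trmxK sA mulmxA.
Qed.

Lemma qform_addvec A u v : sym_mx A ->
  qform A (u + v) = qform A u + 2 * bform A u v + qform A v.
Proof.
move=> sA; have addE (M N : 'M[R]_1) : (M + N) 0 0 = M 0 0 + N 0 0 by rewrite mxE.
rewrite /qform linearD /= mulmxDl !mulmxDr !mulmxDl !addE.
have -> : (v *m A *m u^T) 0 0 = bform A u v by rewrite bformC.
rewrite -/(bform A u v); ring.
Qed.

Lemma bform_scaler A u a v : bform A u (a *: v) = a * bform A u v.
Proof. by rewrite /bform linearZ /= -scalemxAr mxE. Qed.

Lemma bform_delta A i j : bform A (delta_mx 0 i) (delta_mx 0 j) = A i j.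
Proof. by rewrite /bform -rowE trmx_delta -colE !mxE. Qed.

Lemma bform_deltar A v j : bform A v (delta_mx 0 j) = (v *m A) 0 j.
Proof. by rewrite /bform trmx_delta -colE mxE. Qed.

(** Cauchy-Schwarz: [qform A (u + a *: v)] is a nonnegative polynomial in [a], evaluated at its
    vertex. If [qform A v = 0] it is affine, and a nonzero slope would let it take the value -1. *)
Lemma bform_sqr_le A u v : nonneg_def A -> bform A u v ^+ 2 <= qform A u * qform A v.
Proof.
move=> [sA pA].
have key a : 0 <= qform A u + 2 * (a * bform A u v) + a ^+ 2 * qform A v.
  by rewrite -bform_scaler -qform_scalevec -qform_addvec.
have := pA v; rewrite le_eqVlt => /predU1P[v0|v0].
  have [b0|b0] := eqVneq (bform A u v) 0; first by rewrite b0 -v0 expr0n /= mulr0.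
  have := key (- (qform A u + 1) / (2 * bform A u v)).
  rewrite -v0 mulr0 addr0.
  have -> : 2 * (- (qform A u + 1) / (2 * bform A u v) * bform A u v) = - (qform A u + 1).
    by field.
  by have := pA u; lra.
have := key (- bform A u v / qform A v).
have -> : qform A u + 2 * (- bform A u v / qform A v * bform A u v) +
   (- bform A u v / qform A v) ^+ 2 * qform A v =
   (qform A u * qform A v - bform A u v ^+ 2) / qform A v.
  by field; rewrite gt_eqF.
by rewrite pmulr_lge0 ?invr_gt0 // subr_ge0.
Qed.

(** Cauchy-Schwarz against each basis vector kills the coordinates of [v *m A]. *)
Lemma nonneg_def_null A v : nonneg_def A -> qform A v = 0 -> v *m A = 0.
Proof.
move=> pA v0; apply/rowP => j; rewrite -bform_deltar mxE; apply/eqP.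
rewrite -sqrf_eq0 eq_le sqr_ge0 andbT.
by rewrite (le_trans (bform_sqr_le _ (delta_mx 0 j) pA)) // v0 mul0r.
Qed.

Lemma pos_def_nonneg A : pos_def A -> nonneg_def A.
Proof.
move=> [sA pA]; split => // v; have [->|v0] := eqVneq v 0; last exact/ltW/pA.
by rewrite qform0.
Qed.

Lemma pos_def_mul_neq0 A v : pos_def A -> v != 0 -> v *m A != 0.
Proof.
move=> [_ pA] v0; apply/eqP => vA; have := pA _ v0.
by rewrite /qform vA mul0mx mxE ltxx.
Qed.

Lemma pos_def_unitmx A : pos_def A -> A \in unitmx.
Proof.
move=> pA; rewrite -row_free_unit -kermx_eq0; apply/rowV0P => v /sub_kermxP vA.
apply/eqP; apply/negPn/negP => v0; have := pos_def_mul_neq0 pA v0.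
by rewrite vA eqxx.
Qed.

Lemma sym_mxD A B : sym_mx A -> sym_mx B -> sym_mx (A + B).
Proof. by rewrite /sym_mx linearD /= => -> ->. Qed.

Lemma sym_mxZ a A : sym_mx A -> sym_mx (a *: A).
Proof. by rewrite /sym_mx linearZ /= => ->. Qed.

Lemma sym_mxN A : sym_mx A -> sym_mx (- A).
Proof. by rewrite /sym_mx linearN /= => ->. Qed.

Lemma sym_mxB A B : sym_mx A -> sym_mx B -> sym_mx (A - B).
Proof. by move=> sA sB; apply: sym_mxD => //; exact: sym_mxN. Qed.

Lemma sym_mx_scalar a : sym_mx (a%:M : 'M[R]_n).
Proof. exact: tr_scalar_mx. Qed.

Lemma sym_mx_inv A : sym_mx A -> sym_mx (invmx A).
Proof. by move=> sA; rewrite /sym_mx trmx_inv sA. Qed.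

Lemma pos_def_inv A : pos_def A -> pos_def (invmx A).
Proof.
move=> pA; have uA := pos_def_unitmx pA; split; first exact: sym_mx_inv pA.1.
move=> v v0.
have -> : qform (invmx A) v = qform A (v *m invmx A).
  by rewrite qform_mul (sym_mx_inv pA.1) mulVmx // mul1mx.
apply: pA.2; apply/eqP => h; move/eqP: v0; apply.
by rewrite -(mulmxKV uA v) h mul0mx.
Qed.

Lemma nonneg_defD A B : nonneg_def A -> nonneg_def B -> nonneg_def (A + B).
Proof.
move=> [sA pA] [sB pB]; split => [|v]; first exact: sym_mxD.
by rewrite qformD addr_ge0.
Qed.

(** The form is nonnegative at [e_i + e_j] and at [e_i - e_j]. Diagonal estimates thus control all
    entries. *)
Lemma nonneg_def_entry_le A i j : nonneg_def A -> `|A i j| <= (A i i + A j j) / 2.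
Proof.
move=> [sA pA].
have := pA (delta_mx 0 i + delta_mx 0 j); have := pA (delta_mx 0 i + (-1) *: delta_mx 0 j).
rewrite !qform_addvec // bform_scaler qform_scalevec !qform_delta !bform_delta => h1 h2.
rewrite ler_norml; apply/andP; split; lra.
Qed.

Lemma qform_norm_le A v : `|qform A v| <= (\sum_j \sum_i `|A i j|) * qform 1%:M v.
Proof.
have le2 i j : `|v 0 i * v 0 j| <= qform 1%:M v.
  have h k : v 0 k ^+ 2 <= qform 1%:M v.
    by rewrite qform1E (bigD1 k) //= lerDl sumr_ge0 // => m _; exact: sqr_ge0.
  have h1 := h i; have h2 := h j.
  have a1 := sqr_ge0 (v 0 i - v 0 j); have a2 := sqr_ge0 (v 0 i + v 0 j).
  by rewrite ler_norml; apply/andP; split; nra.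
rewrite qformE (le_trans (ler_norm_sum _ _ _)) // mulr_suml ler_sum // => j _.
rewrite (le_trans (ler_norm_sum _ _ _)) // mulr_suml ler_sum // => i _.
rewrite mulrAC mulrC normrM ler_wpM2l //.
Qed.

End QuadraticForms.

(** * Extreme eigenvalues and square roots of symmetric matrices *)

Section Rayleigh.
Variable R : realType.

Lemma qform_continuous n (A : 'M[R]_n) : continuous (qform A).
Proof.
move=> v; have -> : qform A = fun v => \sum_j \sum_i v 0 i * A i j * v 0 j.
  by apply/funext => w; exact: qformE.
apply: (cvg_sumr (F := nbhs v)) => j; apply: (cvg_sumr (F := nbhs v)) => i.
apply: cvgM; last exact: coord_continuous.
by apply: cvgM; [exact: coord_continuous | exact: cvg_cst].
Qed.

(** The form attains a minimum on the compact unit sphere at some [v0]. Subtracting this minimum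
    times the identity leaves a nonnegative matrix whose form vanishes at [v0], so [v0] is in its
    kernel, hence an eigenvector of [A]. *)
Lemma rayleigh_min n (A : 'M[R]_n) : (0 < n)%N -> sym_mx A ->
  exists m, eigenvalue A m /\ forall v, m * qform 1%:M v <= qform A v.
Proof.
move=> n0 sA; pose K : set 'rV[R]_n := [set v | qform 1%:M v = 1].
have K0 : K !=set0.
  by exists (delta_mx 0 (Ordinal n0)); rewrite /K /= qform_delta mxE eqxx.
have cK : compact K.
  apply: bounded_closed_compact.
    exists 1; split; first exact: num_real.
    move=> x x1 v /= Kv; rewrite -[`|v|]/(mx_norm v) mx_normrE.
    apply/bigmax_leP; split => [|[i j] _ /=]; first by rewrite ltW // (lt_trans ltr01).
    rewrite (ord1 i) ltW // (le_lt_trans _ x1) //.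
    rewrite -(ler_pXn2r (n := 2)) ?nnegrE // expr1n real_normK ?num_real //.
    rewrite -Kv qform1E (bigD1 j) //= lerDl sumr_ge0 // => k _; exact: sqr_ge0.
  have -> : K = (qform 1%:M) @^-1` [set 1] by [].
  apply: preimage_closed; first by move=> v _; exact: qform_continuous.
  exact: closed_eq.
have [|v0 /set_mem Kv0 minv] := EVT_min_rV K0 cK (f := qform A).
  by apply: continuous_subspaceT => v; exact: qform_continuous.
exists (qform A v0).
have le v : qform A v0 * qform 1%:M v <= qform A v.
  have [->|vn0] := eqVneq v 0; first by rewrite !qform0 mulr0.
  have q0 := qform1_gt0 vn0; set c := qform 1%:M v in q0 *.
  pose s := (Num.sqrt c)^-1.
  have s2 : s ^+ 2 = c^-1 by rewrite exprVn sqr_sqrtr // ltW.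
  have := minv (s *: v); rewrite inE /K /= !qform_scalevec s2 -/c mulVf ?gt_eqF //.
  by move/(_ erefl); rewrite mulrC ler_pdivlMr.
split => //; apply/eigenvalueP; exists v0; last first.
  by apply/eqP => v00; move: Kv0; rewrite /K /= v00 qform0 => /eqP; rewrite eq_sym oner_eq0.
have pM : nonneg_def (A - (qform A v0)%:M).
  split => [|v]; first exact: sym_mxB sA (sym_mx_scalar _ _).
  by rewrite qformB qform_scalar subr_ge0.
have := nonneg_def_null pM (v := v0); rewrite qformB qform_scalar.
have -> : qform 1%:M v0 = 1 by [].
rewrite mulr1 subrr => /(_ erefl) /eqP.
by rewrite mulmxBr subr_eq0 mul_mx_scalar => /eqP.
Qed.

Lemma eigenvalue_qform n (A : 'M[R]_n) d : eigenvalue A d ->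
  exists2 v, v != 0 & qform A v = d * qform 1%:M v.
Proof.
by move=> /eigenvalueP[v vA v0]; exists v => //; rewrite /qform vA mulmx1 -scalemxAl mxE.
Qed.

(** The Rayleigh minimum inhabits the set from which [eig_min] is chosen, so the default 0 of [xget]
    is never returned. *)
Lemma eig_minP n (A : 'M[R]_n) : (0 < n)%N -> sym_mx A ->
  eigenvalue A (eig_min A) /\ forall v, eig_min A * qform 1%:M v <= qform A v.
Proof.
move=> n0 sA; have [m [em hm]] := rayleigh_min n0 sA.
have hm' e : eigenvalue A e -> m <= e.
  move=> /eigenvalue_qform[v v0 vA]; have := hm v.
  by rewrite vA ler_pM2r // qform1_gt0.
suff -> : eig_min A = m by [].
rewrite /eig_min; case: xgetP => [d _ [ed hd]|/(_ m) []]; last by split.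
by apply/le_anti; rewrite hd //= hm'.
Qed.

Lemma eig_maxP n (A : 'M[R]_n) : (0 < n)%N -> sym_mx A ->
  eigenvalue A (eig_max A) /\ forall v, qform A v <= eig_max A * qform 1%:M v.
Proof.
move=> n0 sA; have [m [em hm]] := rayleigh_min n0 (sym_mxN sA).
have em' : eigenvalue A (- m).
  move/eigenvalueP: em => [v vA v0]; apply/eigenvalueP; exists v => //.
  by rewrite scaleNr -vA mulmxN opprK.
have hm' v : qform A v <= - m * qform 1%:M v.
  by have := hm v; rewrite qformN; lra.
have hm2 e : eigenvalue A e -> e <= - m.
  move=> /eigenvalue_qform[v v0 vA]; have := hm' v.
  by rewrite vA ler_pM2r // qform1_gt0.
suff -> : eig_max A = - m by [].
rewrite /eig_max; case: xgetP => [d _ [ed hd]|/(_ (- m)) []]; last by split.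
by apply/le_anti; rewrite hd //= hm2.
Qed.

Lemma eig_min_ge n (A : 'M[R]_n) c : (0 < n)%N -> sym_mx A ->
  (forall v, c * qform 1%:M v <= qform A v) -> c <= eig_min A.
Proof.
move=> n0 sA hc; have [/eigenvalue_qform[v v0 vA] _] := eig_minP n0 sA.
by have := hc v; rewrite vA ler_pM2r // qform1_gt0.
Qed.

(* Peeling off a positive eigenvalue [lam] with unit eigenvector [v] leaves
   [A - lam v^T v], nonnegative of smaller rank; any square root of it kills [v]. *)
Lemma nonneg_def_sqrt n (A : 'M[R]_n) : (0 < n)%N -> nonneg_def A ->
  exists S, nonneg_def S /\ S *m S = A.
Proof.
move=> n0; have [r] := ubnP (\rank A); elim: r A => // r IH A rA pA.
have [sA qA] := pA.
have [em lM] := eig_maxP n0 sA; set lam := eig_max A in em lM.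
have [l0|l0] := leP lam 0.
  have -> : A = 0.
    apply/row_matrixP => i; rewrite row0 rowE; apply: nonneg_def_null => //.
    apply/le_anti; rewrite qA andbT (le_trans (lM _)) //.
    by rewrite mulr_le0_ge0 // qform1_ge0.
  exists 0; split; last by rewrite mul0mx.
  by split => [|v]; [exact: trmx0 | rewrite /qform mulmx0 mul0mx mxE].
case/eigenvalueP: em => w wA w0.
pose s := (Num.sqrt (qform 1%:M w))^-1; pose v := s *: w.
have q0 := qform1_gt0 w0.
have qv : qform 1%:M v = 1.
  by rewrite /v qform_scalevec exprVn sqr_sqrtr ?ltW // mulVf // gt_eqF.
have vA : v *m A = lam *: v by rewrite /v -scalemxAl wA scalerA mulrC -scalerA.
have Av : A *m v^T = lam *: v^T by rewrite -[in LHS]sA -trmx_mul vA linearZ.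
have vvT : v *m v^T = 1%:M.
  by apply/matrixP => i j; rewrite !ord1 [RHS]mxE /= -qv /qform mulmx1.
pose V := v^T *m v.
have sV : sym_mx V by rewrite /sym_mx /V trmx_mul trmxK.
have qV u : qform V u = (bform 1%:M u v) ^+ 2.
  rewrite /qform /V /bform mulmx1 mulmxA -mulmxA.
  have -> : v *m u^T = (u *m v^T)^T by rewrite trmx_mul trmxK.
  by rewrite mxE big_ord1 [X in _ * X = _]mxE expr2.
pose B := A - lam *: V.
(* Cauchy-Schwarz for [A] at [u] and [v] reads [lam^2 <u, v>^2 <= lam * qform A u]; divide by
   [lam]. *)
have pB : nonneg_def B.
  split => [|u]; first by apply: sym_mxB => //; exact: sym_mxZ.
  rewrite qformB qformZ qV subr_ge0.
  have := bform_sqr_le u v pA.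
  have -> : bform A u v = lam * bform 1%:M u v.
    by rewrite /bform -mulmxA Av mulmx1 -scalemxAr mxE.
  have -> : qform A v = lam by rewrite /qform vA -scalemxAl vvT !mxE mulr1.
  rewrite exprMn [lam ^+ 2]expr2 [X in _ <= X]mulrC -mulrA ler_pM2l //.
have vB : v *m B = 0.
  by rewrite mulmxBr vA -scalemxAr /V mulmxA vvT mul1mx subrr.
(* Vectors killed by [A] are orthogonal to [v], hence killed by [B]; the kernel also gains [v]
   itself, so the rank drops. *)
have kAB : (kermx A < kermx B)%MS.
  rewrite ltmxE; apply/andP; split.
    apply/sub_kermxP; rewrite mulmxBr mulmx_ker sub0r -scalemxAr /V mulmxA.
    have -> : kermx A *m v^T = lam^-1 *: (kermx A *m (A *m v^T)).
      by rewrite Av -scalemxAr scalerA mulVf ?gt_eqF // scale1r.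
    by rewrite mulmxA mulmx_ker mul0mx scaler0 mul0mx scaler0 oppr0.
  apply/negP => /(submx_trans (introT sub_kermxP vB)) /sub_kermxP.
  rewrite vA => /eqP; rewrite scaler_eq0 gt_eqF //= => /eqP v0.
  by move: qv; rewrite v0 qform0 => /eqP; rewrite eq_sym oner_eq0.
have rB : (\rank B < r)%N.
  have := rank_ltmx kAB; rewrite !mxrank_ker => h.
  have := rank_leq_row B; have := rank_leq_row A; move: rA h; lia.
have [S [pS SS]] := IH B rB pB.
have vS : v *m S = 0.
  apply/eqP; rewrite -qform1_eq0 qform_mul mulmx1 pS.1 SS.
  by rewrite /qform vB mul0mx mxE.
have Sv : S *m v^T = 0 by rewrite -[S]pS.1 -trmx_mul vS trmx0.
exists (S + Num.sqrt lam *: V); split.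
  apply: nonneg_defD => //; split => [|u]; first exact: sym_mxZ.
  by rewrite qformZ qV mulr_ge0 ?sqrtr_ge0 // sqr_ge0.
rewrite mulmxDl !mulmxDr SS -!scalemxAr -!scalemxAl.
rewrite {1 2}/V mulmxA Sv mul0mx -(mulmxA v^T v S) vS mulmx0 !scaler0 addr0 add0r.
have -> : V *m V = V by rewrite /V mulmxA -(mulmxA v^T) vvT mulmx1.
by rewrite scalerA -expr2 sqr_sqrtr ?(ltW l0) // subrK.
Qed.

Lemma sqrtmP n (A : 'M[R]_n) : (0 < n)%N -> nonneg_def A ->
  nonneg_def (sqrtm A) /\ sqrtm A *m sqrtm A = A.
Proof.
move=> n0 pA; have [S SP] := nonneg_def_sqrt n0 pA.
by rewrite /sqrtm; case: xgetP => [//|/(_ S)].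
Qed.

End Rayleigh.

(** * Curves of symmetric matrices *)

Section Derivatives.
Variable R : realType.

Lemma is_derive1_quotient (f : R -> R) (t d : R) : is_derive t 1 f d <->
  (h^-1 * (f (t + h) - f t)) @[h --> 0^'] --> d.
Proof.
have E : (fun h : R => h^-1 * (f (t + h) - f t)) =
         (fun h => h^-1 *: ((f \o shift t) (h *: (1 : R)) - f t)).
  by apply/funext => h /=; rewrite [h *: _]mulr1 [h + t]addrC.
rewrite E; split => [[df <-]|df]; first exact: df.
by split; [apply/cvg_ex; exists d | exact: cvg_lim df].
Qed.

Lemma deriv_within_interior (I : set R) (f : R -> R) (t d : R) : nbhs t I ->
  deriv_within I f t d -> is_derive t 1 f d.
Proof.
move=> It df; have {}It : \forall h \near 0, I (t + h).
  by rewrite (near_shift t 0); apply: filterS It => s; rewrite /= sub0r addrCA subrr addr0.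
apply/is_derive1_quotient => U /df; rewrite !nbhs_simpl /=.
by rewrite /dnbhs /within /=; move: It; apply: filterS2 => h Ih hU h0; exact: hU.
Qed.

Lemma is_derive_deriv_within (I : set R) (f : R -> R) (t d : R) :
  is_derive t 1 f d -> deriv_within I f t d.
Proof.
move=> /is_derive1_quotient df U /df; rewrite !nbhs_simpl /=.
by rewrite /dnbhs /within /=; apply: filterS => h hU [h0 _]; exact: hU.
Qed.

(** Writing [f (T + h)] as [h] times the quotient plus [f T] extracts left continuity from the
    one-sided derivative at [T]; this is what [curve] records at the endpoint. *)
Lemma deriv_within_at_left (f : R -> R) (T d : R) :
  deriv_within `]-oo, T] f T d -> f s @[s --> T^'-] --> f T.
Proof.
move=> df; have {}df : (h^-1 * (f (T + h) - f T)) @[h --> 0^'-] --> d.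
  apply: cvg_trans df => U; rewrite /at_left /within !nbhs_simpl /=.
  apply: filterS => h hU h0; apply: hU.
  by rewrite /= in_itv /= -subr_ge0 opprD addrA subrr sub0r oppr_ge0 ltW // lt_eqF.
have h0 : h @[h --> (0 : R)^'-] --> (0 : R) by exact: cvg_within.
have fT : (h * (h^-1 * (f (T + h) - f T)) + f T) @[h --> (0 : R)^'-] --> f T.
  rewrite -[X in _ --> X]add0r -[X in _ --> X + _](mul0r d).
  by apply: cvgD; [exact: cvgM | exact: cvg_cst].
have : f (T + h) @[h --> 0^'-] --> f T.
  apply: cvg_trans fT; apply: near_eq_cvg; near=> h.
  have h0' : h != 0 by rewrite lt_eqF //; near: h; exact: nbhs_left_lt.
  by rewrite /= mulrA mulfV // mul1r subrK.
move=> {}fT U /fT; rewrite /at_left /within !nbhs_simpl /= => hU.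
suff : \forall s \near T, s < T -> U (f s) by [].
rewrite (near_shift 0 T); apply: filterS hU => h hU /=.
by rewrite subr0 [h + T]addrC gtrDl => /hU.
Unshelve. all: by end_near. Qed.

Lemma is_derive1_continuous (f : R -> R) (t d : R) :
  is_derive t 1 f d -> f s @[s --> t] --> f t.
Proof. by move=> [df _]; apply: differentiable_continuous; apply/derivable1_diffP. Qed.

End Derivatives.

(** * Backward propagation of positive definiteness *)

Section MatrixCurves.
Variables (R : realType) (n : nat).

Lemma cvg_qform (X : Type) (F : set_system X) {FF : Filter F}
    (M : X -> 'M[R]_n) (A : 'M[R]_n) v :
  (forall i j, M x i j @[x --> F] --> A i j) ->
  qform (M x) v @[x --> F] --> qform A v.
Proof.
move=> MA; under eq_cvg do rewrite qformE; rewrite qformE.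
apply: cvg_sumr => j; apply: cvg_sumr => i.
apply: cvgM; last exact: cvg_cst.
by apply: cvgM => //; exact: cvg_cst.
Qed.

(** The smallest eigenvalue [m] of the limit is a margin uniform in [v]: eventually the sum of the
    entry errors, which bounds the error of the form relative to the squared norm, is below [m]. *)
Lemma near_pos_def (X : Type) (F : set_system X) {FF : Filter F}
    (M : X -> 'M[R]_n) (A : 'M[R]_n) : (0 < n)%N -> pos_def A ->
  (forall i j, M x i j @[x --> F] --> A i j) ->
  \forall x \near F, forall v, v != 0 -> 0 < qform (M x) v.
Proof.
move=> n0 [sA pA] MA; have [/eigenvalue_qform[w w0 wA] lA] := eig_minP n0 sA.
set m := eig_min A in wA lA.
have m0 : 0 < m by have := pA _ w0; rewrite wA pmulr_lgt0 // qform1_gt0.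
have : (\sum_j \sum_i `|M x i j - A i j|) @[x --> F] --> (\sum_(j < n) \sum_(i < n) 0 : R).
  apply: cvg_sumr => j; apply: cvg_sumr => i.
  rewrite -(normr0 R) -(subrr (A i j)); apply: cvg_norm.
  by apply: cvgB => //; exact: cvg_cst.
rewrite !big1 // => /cvgrPdist_lt /(_ m m0); apply: filterS => x.
rewrite sub0r normrN ger0_norm; last by do 2![apply: sumr_ge0 => ? _].
move=> xm v v0; have := qform_norm_le (M x - A) v; rewrite qformB.
under eq_bigr do under eq_bigr do rewrite !mxE.
have := lA v; have q0 := qform1_gt0 v0; move: xm; set s := \sum_j _ => xm.
have : s * qform 1%:M v < m * qform 1%:M v by rewrite ltr_pM2r.
by rewrite ler_norml => h1 h2 /andP[h3 h4]; lra.
Qed.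

(** Derivatives are two-sided but only before [T], where left continuity takes over; values beyond
    [T] do not matter. *)
Definition curve (T : R) (X dX : R -> 'M[R]_n) : Prop :=
  [/\ forall t, t <= T -> sym_mx (X t),
      forall t, t < T -> forall i j, is_derive t 1 (fun s => X s i j) (dX t i j)
    & forall i j, X s i j @[s --> T^'-] --> X T i j].

Lemma curveD T X dX Y dY : curve T X dX -> curve T Y dY ->
  curve T (fun s => X s + Y s) (fun s => dX s + dY s).
Proof.
move=> [sX DX cX] [sY DY cY]; split => [t tT|t tT i j|i j].
- by apply: sym_mxD; [exact: sX | exact: sY].
- have -> : (fun s => (X s + Y s) i j) = (fun s => X s i j) + (fun s => Y s i j).
    by apply/funext => s; rewrite mxE.
  by rewrite mxE; apply: is_deriveD; [exact: DX | exact: DY].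
- under eq_cvg do rewrite mxE; rewrite mxE; exact: cvgD.
Qed.

Lemma curveZ T a X dX : curve T X dX -> curve T (fun s => a *: X s) (fun s => a *: dX s).
Proof.
move=> [sX DX cX]; split => [t tT|t tT i j|i j].
- by apply: sym_mxZ; exact: sX.
- have -> : (fun s => (a *: X s) i j) = a \*: (fun s => X s i j).
    by apply/funext => s; rewrite mxE.
  by rewrite mxE; apply: is_deriveZ; exact: DX.
- under eq_cvg do rewrite mxE; rewrite mxE; apply: cvgM => //; exact: cvg_cst.
Qed.

Lemma curveB T X dX Y dY : curve T X dX -> curve T Y dY ->
  curve T (fun s => X s - Y s) (fun s => dX s - dY s).
Proof.
move=> cX cY; have := curveD cX (curveZ (-1) cY).
by under eq_fun do rewrite scaleN1r; under [X in curve _ _ X]eq_fun do rewrite scaleN1r.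
Qed.

Lemma curve_scale (T : R) (g dg : R -> R) (A : 'M[R]_n) : sym_mx A ->
  (forall t, t < T -> is_derive t 1 g (dg t)) -> g s @[s --> T^'-] --> g T ->
  curve T (fun s => g s *: A) (fun s => dg s *: A).
Proof.
move=> sA Dg cg; split => [t tT|t tT i j|i j]; first exact: sym_mxZ.
- have -> : (fun s => (g s *: A) i j) = A i j \*: g.
    by apply/funext => s; rewrite mxE mulrC.
  rewrite mxE mulrC; apply: is_deriveZ; exact: Dg.
- under eq_cvg do rewrite mxE; rewrite mxE; apply: cvgM => //; exact: cvg_cst.
Qed.

Lemma curve_cvg (T : R) X dX (t : R) i j : curve T X dX -> t <= T ->
  X s i j @[s --> within (fun u => u <= T) (nbhs t)] --> X t i j.
Proof.
move=> [_ DX cX]; rewrite le_eqVlt => /predU1P[->|tT].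
  by apply: cvg_at_left_within; exact: cX.
by apply: cvg_within_filter; apply: is_derive1_continuous; exact: DX.
Qed.

(* At the last time where positivity fails, some [v] is in the kernel and the
   quadratic form at [v] increases from 0, which the sign of its derivative forbids. *)
Lemma curve_pos_def (T : R) X dX : (0 < n)%N -> curve T X dX -> pos_def (X T) ->
  (forall t v, t < T -> nonneg_def (X t) -> v != 0 -> v *m X t = 0 ->
     qform (dX t) v < 0) ->
  forall t, t <= T -> pos_def (X t).
Proof.
move=> n0 cX pT exitX t0 t0T; have [sX DX _] := cX.
apply: contrapT => npd.
pose E := [set t | t0 <= t <= T /\ exists2 v, v != 0 & qform (X t) v <= 0].
have npdE t : t <= T -> (forall v, v != 0 -> 0 < qform (X t) v) -> pos_def (X t).
  by move=> tT h; split => //; exact: sX.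
have Et0 : E t0.
  split; first by rewrite lexx t0T.
  apply: contrapT => h; apply: npd; apply: npdE => // v v0.
  by rewrite ltNge; apply/negP => q0; apply: h; exists v.
have ubE : ubound E T by move=> t [/andP[]].
have supE : has_sup E by split; [exists t0 | exists T].
pose s := sup E.
have sT : s <= T by apply: ge_sup => //; exists t0.
have s0 : t0 <= s by apply: ub_le_sup => //; exists T.
have pos_gt t : s < t -> t <= T -> forall v, v != 0 -> 0 < qform (X t) v.
  move=> st tT v v0; rewrite ltNge; apply/negP => q0.
  suff : t <= s by rewrite leNgt st.
  apply: ub_le_sup; first by exists T.
  by split; [rewrite tT (le_trans s0) // ltW | exists v].
(* Positivity at [s] would persist near [s] up to [T], yet [E] has elements arbitrarily close to its
   supremum. *)
have npds : ~ pos_def (X s).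
  move=> pds; have := near_pos_def n0 pds (fun i j => @curve_cvg _ _ _ _ i j cX sT).
  move=> /(_ (within_filter _ _)); rewrite near_withinE => /nbhs_ballP[e /= e0 be].
  have [t Et st] := sup_adherent e0 supE.
  have ts : t <= s by apply: ub_le_sup => //; exists T.
  have [/andP[_ tT] [v v0]] := Et; rewrite leNgt => /negP; apply.
  apply: be => //; rewrite /ball /= ger0_norm ?subr_ge0 //.
  by move: st; rewrite -/s; lra.
have {}sT : s < T by rewrite lt_neqAle sT andbT; apply/eqP => sT'; rewrite sT' in npds.
have [v v0 qv] : exists2 v, v != 0 & qform (X s) v <= 0.
  apply: contrapT => h; apply: npds; apply: npdE; first exact: ltW.
  by move=> v v0; rewrite ltNge; apply/negP => q0; apply: h; exists v.
(* A negative value at [s] would persist shortly after [s], where all values are positive. *)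
have nns : nonneg_def (X s).
  split => [|w]; first exact/sX/ltW.
  have [->|w0] := eqVneq w 0; first by rewrite qform0.
  rewrite leNgt; apply/negP => qw.
  have : qform (X u) w @[u --> s] --> qform (X s) w.
    by apply: cvg_qform => i j; apply: is_derive1_continuous; exact: DX.
  move=> /cvgr_lt /(_ _ qw) /nbhs_ballP[e /= e0 be].
  pose u := s + Num.min e (T - s) / 2.
  have m0 : 0 < Num.min e (T - s) by rewrite lt_min e0 subr_gt0.
  have me : Num.min e (T - s) <= e by rewrite ge_min lexx.
  have mT : Num.min e (T - s) <= T - s by rewrite ge_min lexx orbT.
  have su : s < u by rewrite /u; lra.
  have uT : u <= T by rewrite /u; lra.
  have : qform (X u) w < 0.
    by apply: be; rewrite /ball /= ltr_norml /u; apply/andP; split; lra.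
  by rewrite ltNge (ltW (pos_gt _ su uT _ w0)).
have qv0 : qform (X s) v = 0 by apply/le_anti; rewrite qv nns.2.
have dneg := exitX _ _ sT nns v0 (nonneg_def_null nns qv0).
have : qform (h^-1 *: (X (s + h) - X s)) v @[h --> 0^'] --> qform (dX s) v.
  apply: cvg_qform => i j; have /is_derive1_quotient H := DX _ sT i j.
  by under eq_cvg do rewrite !mxE.
move=> /cvgr_lt /(_ _ dneg); rewrite near_withinE => /nbhs_ballP[e /= e0 be].
pose h := Num.min e (T - s) / 2.
have m0 : 0 < Num.min e (T - s) by rewrite lt_min e0 subr_gt0.
have me : Num.min e (T - s) <= e by rewrite ge_min lexx.
have mT : Num.min e (T - s) <= T - s by rewrite ge_min lexx orbT.
have h0 : 0 < h by rewrite /h; lra.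
have : qform (h^-1 *: (X (s + h) - X s)) v < 0.
  apply: be; last by rewrite gt_eqF.
  by rewrite /ball /= ltr_norml /h; apply/andP; split; lra.
rewrite qformZ qformB qv0 subr0 pmulr_rlt0 ?invr_gt0 // ltNge => /negP; apply.
by apply: ltW; apply: pos_gt => //; rewrite /h; lra.
Qed.

End MatrixCurves.

(** * Comparison for the Riccati equation *)

Section Riccati.
Variables (R : realType) (n : nat) (Lam Sig : 'M[R]_n) (alpha : R) (theta : 'I_n -> R).
Hypotheses (n_gt0 : (0 < n)%N) (alpha_ge0 : 0 <= alpha) (Lam_pos : pos_def Lam)
  (Sig_ge0 : nonneg_def Sig) (theta_ge0 : forall i, 0 <= theta i).

Local Notation F := (riccati_rhs Lam Sig alpha theta).
Let th := \sum_i theta i.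

Definition riccati_curve (T : R) (X : R -> 'M[R]_n) := curve T X (fun t => F (X t)).

(** For symmetric [C], the form at [v] of the term [C diag(theta_k / c_kk) C], as a weighted sum of
    squares. *)
Definition penalty (C : 'M[R]_n) (v : 'rV[R]_n) :=
  \sum_k theta k / C k k * (v *m C) 0 k ^+ 2.

Lemma qform_riccati_rhs C v : sym_mx C ->
  qform (F C) v = qform (invmx Lam) (v *m C) + penalty C v - alpha * qform Sig v.
Proof.
move=> sC; rewrite /riccati_rhs qformB qformD qformZ; congr (_ + _ - _).
  by rewrite qform_mul sC.
have -> : qform (C^T *m diag_mx (\row_i (theta i / C i i)) *m C) v =
          qform (diag_mx (\row_i (theta i / C i i))) (v *m C).
  by rewrite qform_mul sC.
rewrite /penalty; move: (v *m C) => w; rewrite /qform mul_mx_diag mxE.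
by apply: eq_bigr => k _; rewrite !mxE mulrAC -expr2 mulrC.
Qed.

Lemma penalty_ge0 C v : nonneg_def C -> 0 <= penalty C v.
Proof.
move=> [_ pC]; apply: sumr_ge0 => k _; rewrite mulr_ge0 ?sqr_ge0 // divr_ge0 //.
by rewrite -qform_delta.
Qed.

(** Cauchy-Schwarz bounds [(v C)_k^2] by [c_kk * qform C v], which cancels the denominator. When
    [c_kk = 0] the quotient is 0, since the inverse of 0 is 0. *)
Lemma penalty_le C v : nonneg_def C -> penalty C v <= th * qform C v.
Proof.
move=> pC; rewrite /th mulr_suml; apply: ler_sum => k _.
have := bform_sqr_le v (delta_mx 0 k) pC; rewrite bform_deltar qform_delta => cs.
have := pC.2 (delta_mx 0 k); rewrite qform_delta le_eqVlt => /predU1P[<-|c0].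
  by rewrite invr0 mulr0 mul0r mulr_ge0 //; exact: pC.2.
by rewrite -mulrA ler_wpM2l // mulrC ler_pdivrMr.
Qed.

Lemma qform_invLam a v : qform (invmx Lam) (a *: (v *m Lam)) = a ^+ 2 * qform Lam v.
Proof.
rewrite qform_scalevec qform_mul (Lam_pos.1 : Lam^T = Lam) mulmxV ?mul1mx //.
exact: pos_def_unitmx.
Qed.

Lemma riccati_lower T X (g dg : R -> R) d : riccati_curve T X ->
  (forall t : R, t < T -> is_derive t 1 g (dg t)) -> g s @[s --> T^'-] --> g T ->
  (forall t, t <= T -> 0 < g t) ->
  (forall v, d * qform Lam v <= qform Sig v) ->
  (forall t, t < T -> g t ^+ 2 + th * g t - alpha * d < dg t) ->
  pos_def (X T - g T *: Lam) -> forall t, t <= T -> pos_def (X t - g t *: Lam).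
Proof.
move=> cX Dg cg g0 dS gd pT.
apply: (curve_pos_def n_gt0 (curveB cX (curve_scale Lam_pos.1 Dg cg)) pT).
move=> t v tT nnA v0; rewrite mulmxBr -scalemxAr => /eqP; rewrite subr_eq0 => /eqP vX.
have sX : sym_mx (X t) by case: cX => sX _ _; exact/sX/ltW.
have nnX : nonneg_def (X t).
  split => // w; have := nnA.2 w; rewrite qformB qformZ subr_ge0; apply: le_trans.
  by rewrite mulr_ge0 ?(ltW (g0 _ (ltW tT))) //; exact: (pos_def_nonneg Lam_pos).2.
have qX : qform (X t) v = g t * qform Lam v by rewrite /qform vX -scalemxAl mxE.
rewrite qformB qformZ qform_riccati_rhs // vX qform_invLam.
have L0 := Lam_pos.2 _ v0; have := penalty_le v nnX; rewrite qX => pen.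
have dS' : alpha * (d * qform Lam v) <= alpha * qform Sig v by rewrite ler_wpM2l.
have := gd _ tT; rewrite -(ltr_pM2r L0); nra.
Qed.

(** Dual exit argument: the penalty is now bounded below by 0, so [theta] disappears from the scalar
    inequality, at the price of knowing that [X] is positive definite. *)
Lemma riccati_upper T X (h dh : R -> R) d : riccati_curve T X ->
  (forall t, t <= T -> pos_def (X t)) ->
  (forall t : R, t < T -> is_derive t 1 h (dh t)) -> h s @[s --> T^'-] --> h T ->
  (forall v, qform Sig v <= d * qform Lam v) ->
  (forall t, t < T -> dh t < h t ^+ 2 - alpha * d) ->
  pos_def (h T *: Lam - X T) -> forall t, t <= T -> pos_def (h t *: Lam - X t).
Proof.
move=> cX pX Dh ch dS hd pT.
apply: (curve_pos_def n_gt0 (curveB (curve_scale Lam_pos.1 Dh ch) cX) pT).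
move=> t v tT nnA v0; rewrite mulmxBr -scalemxAr => /eqP; rewrite subr_eq0 => /eqP vX.
have pXt := pX _ (ltW tT); have sX := pXt.1.
rewrite qformB qformZ qform_riccati_rhs // -vX qform_invLam.
have L0 := Lam_pos.2 _ v0; have pen := penalty_ge0 v (pos_def_nonneg pXt).
have dS' : alpha * qform Sig v <= alpha * (d * qform Lam v) by rewrite ler_wpM2l.
have := hd _ tT; rewrite -(ltr_pM2r L0); nra.
Qed.

(** Lower comparison, with [d = 0], against the exponential [e exp(k (t - T)) Lam]. *)
Lemma riccati_curve_pos T X : riccati_curve T X -> pos_def (X T) ->
  forall t, t <= T -> pos_def (X t).
Proof.
move=> cX pT.
have [/eigenvalue_qform[w w0 wX] mX] := eig_minP n_gt0 pT.1.
have [/eigenvalue_qform[u u0 uL] ML] := eig_maxP n_gt0 Lam_pos.1.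
set m := eig_min _ in wX mX; set M := eig_max _ in uL ML.
have m0 : 0 < m by have := pT.2 _ w0; rewrite wX pmulr_lgt0 // qform1_gt0.
have M0 : 0 < M by have := Lam_pos.2 _ u0; rewrite uL pmulr_lgt0 // qform1_gt0.
(* With this [e], [e Lam <= (m / 2) I] lies strictly below [X T]. *)
pose e := m / (2 * M); have e0 : 0 < e by rewrite divr_gt0 // mulr_gt0.
have th0 : 0 <= th by exact: sumr_ge0.
(* Since [g <= e] before [T], this rate gives [g^2 + th g <= (e + th) g < k g]. *)
pose k := e + th + 1; have k0 : 0 < k by rewrite /k; lra.
pose g t := e * expR (k * (t - T)).
have g0 t : 0 < g t by rewrite mulr_gt0 // expR_gt0.
have Dg (t : R) : is_derive t 1 g (k * g t).
  have D1 : is_derive t 1 (fun s : R => k * (s - T)) k.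
    by apply: is_derive_eq; rewrite /GRing.scale /=; ring.
  have D2 := @is_derive1_comp _ expR (fun s : R => k * (s - T)) _ _ _ (is_derive_expR _) D1.
  by apply: is_derive_eq (is_deriveZ e D2) _; rewrite /g /GRing.scale /=; ring.
have := @riccati_lower T X g (fun t => k * g t) 0 cX.
have PL := (pos_def_nonneg Lam_pos).2.
move=> /(_ (fun t _ => Dg t)) /(_ _ (fun t _ => g0 t)) H t tT.
have pA : pos_def (X t - g t *: Lam).
  apply: H tT.
  - by apply: cvg_at_left_filter; exact: is_derive1_continuous (Dg T).
  - by move=> v; rewrite mul0r; exact: Sig_ge0.2.
  - move=> s sT; rewrite mulr0 subr0.
    have ge : g s <= e.
      rewrite -[leRHS]mulr1 ler_pM2l // -expR0 ler_expR.
      by rewrite pmulr_rle0 // subr_le0 ltW.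
    have := g0 s; rewrite /k; nra.
  - split; first exact: sym_mxB pT.1 (sym_mxZ _ Lam_pos.1).
    move=> v v0; rewrite qformB qformZ /g subrr mulr0 expR0 mulr1 subr_gt0.
    have q0 := qform1_gt0 v0.
    apply: (lt_le_trans _ (mX v)); apply: (@le_lt_trans _ _ (e * (M * qform 1%:M v))).
      by rewrite ler_wpM2l // ltW.
    have -> : e * (M * qform 1%:M v) = m / 2 * qform 1%:M v.
      by rewrite /e; field; rewrite gt_eqF.
    by rewrite ltr_pM2r //; lra.
split => [|v v0]; first by case: cX => sX _ _; exact: sX.
have := pA.2 _ v0; rewrite qformB qformZ subr_gt0; apply: le_lt_trans.
by rewrite mulr_ge0 // ltW.
Qed.

(* Since [F (a X) - a F X = a (a - 1) X Lam^-1 X + (a - 1) alpha Sig] is positive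
   definite for [a > 1], the dilation [a X2] is a strict supersolution. *)
Lemma riccati_comparison T X1 X2 : riccati_curve T X1 -> riccati_curve T X2 ->
  pos_def (X1 T) -> loewner_le (X1 T) (X2 T) ->
  forall t, t <= T -> loewner_le (X1 t) (X2 t).
Proof.
move=> c1 c2 p1T le12.
have sX2 : sym_mx (X2 T) by case: c2 => s2 _ _; exact: s2.
have p2T : pos_def (X2 T).
  split => // v v0; have := le12.2 v; rewrite qformB subr_ge0.
  by apply: lt_le_trans; exact: p1T.2.
have p1 := riccati_curve_pos c1 p1T; have p2 := riccati_curve_pos c2 p2T.
have key (e : R) : 0 < e -> forall t, t <= T -> pos_def ((1 + e) *: X2 t - X1 t).
  move=> e0; apply: (curve_pos_def n_gt0 (curveB (curveZ (1 + e) c2) c1)).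
    split; first by apply: sym_mxB => //; [exact: sym_mxZ | exact: p1T.1].
    move=> v v0; have := le12.2 v; have := p2T.2 _ v0; rewrite !qformB qformZ.
    by nra.
  move=> t v tT nnA v0; rewrite mulmxBr -scalemxAr => /eqP; rewrite subr_eq0 => /eqP vX.
  have tT' := ltW tT; have P1 := p1 _ tT'; have P2 := p2 _ tT'.
  rewrite qformB qformZ !qform_riccati_rhs ?P1.1 ?P2.1 //; [|exact: P1.1|exact: P2.1].
  rewrite -vX qform_scalevec.
  set w := v *m X2 t; have w0 : w != 0 by exact: pos_def_mul_neq0.
  have qw : 0 < qform (invmx Lam) w by exact: (pos_def_inv Lam_pos).2.
  have qS : 0 <= alpha * qform Sig v by rewrite mulr_ge0 //; exact: Sig_ge0.2.
  (* With [w = v X2] the contact relation reads [v X1 = (1 + e) w]: the squares in the penalty of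
     [X1] gain [(1 + e)^2], and [x1_kk <= (1 + e) x2_kk] costs only one of the two factors. *)
  have pen : (1 + e) * penalty (X2 t) v <= penalty (X1 t) v.
    rewrite mulr_sumr; apply: ler_sum => k _; rewrite -vX -/w [(_ *: w) 0 k]mxE exprMn.
    have x1 : 0 < X1 t k k by rewrite -qform_delta; apply: P1.2; exact: delta_rV_neq0.
    have x2 : 0 < X2 t k k by rewrite -qform_delta; apply: P2.2; exact: delta_rV_neq0.
    have x12 : X1 t k k <= (1 + e) * X2 t k k.
      by have := nnA.2 (delta_mx 0 k); rewrite qformB qformZ !qform_delta subr_ge0.
    have -> : (1 + e) * (theta k / X2 t k k * w 0 k ^+ 2) =
       (theta k * (1 + e) * w 0 k ^+ 2) * (X2 t k k)^-1 by ring.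
    have -> : theta k / X1 t k k * ((1 + e) ^+ 2 * w 0 k ^+ 2) =
       (theta k * (1 + e) * w 0 k ^+ 2) * ((1 + e) / X1 t k k) by ring.
    apply: ler_wpM2l; first by rewrite mulr_ge0 ?sqr_ge0 // mulr_ge0 //; lra.
    by rewrite ler_pdivlMr // mulrC ler_pdivrMr.
  by nra.
move=> t tT; split.
  by apply: sym_mxB; [exact: (p2 t tT).1 | exact: (p1 t tT).1].
move=> v; rewrite qformB subr_ge0; apply/ler_addgt0Pr => e e0.
have q0 : 0 < qform (X2 t) v + 1.
  by rewrite ltr_wpDl // (pos_def_nonneg (p2 t tT)).2.
have e1 : 0 < e / (qform (X2 t) v + 1) by rewrite divr_gt0.
have := (pos_def_nonneg (key _ e1 t tT)).2 v.
rewrite qformB qformZ subr_ge0 => /le_trans; apply.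
rewrite mulrDl mul1r lerD2l mulrAC ler_pdivrMr //.
by rewrite ler_pM2l // lerDl.
Qed.

(** For every [T' > T] the function [h s = alpha d + 1 + 1 / (T' - s)] satisfies
    [h' < h^2 - alpha d]. With [T'] close to [T] it starts above [X T], and at [t] it is smaller
    than the same expression with [T], so the final bound forgets [X T]. *)
Lemma riccati_blowup_bound T X (d : R) : riccati_curve T X -> pos_def (X T) -> 0 <= d ->
  (forall v, qform Sig v <= d * qform Lam v) ->
  forall t v, t < T -> qform (X t) v <= (alpha * d + 1 + (T - t)^-1) * qform Lam v.
Proof.
move=> cX pT d0 dS t v tT; have pX := riccati_curve_pos cX pT.
have [/eigenvalue_qform[w w0 wX] MX] := eig_maxP n_gt0 pT.1.
have [/eigenvalue_qform[u u0 uL] mL] := eig_minP n_gt0 Lam_pos.1.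
set M := eig_max _ in wX MX; set m := eig_min _ in uL mL.
have M0 : 0 < M by have := pT.2 _ w0; rewrite wX pmulr_lgt0 // qform1_gt0.
have m0 : 0 < m by have := Lam_pos.2 _ u0; rewrite uL pmulr_lgt0 // qform1_gt0.
pose K := M / m; have K0 : 0 < K by rewrite divr_gt0.
(* [K Lam] dominates [X T], and this [T'] yields [h T = alpha d + K + 2]. *)
pose T' := T + (K + 1)^-1; have TT' : T < T' by rewrite ltrDl invr_gt0; lra.
have ad0 : 0 <= alpha * d by rewrite mulr_ge0.
pose h s := alpha * d + 1 + (T' - s)^-1.
pose dh s := (T' - s) ^- 2.
have Dh (s : R) : s <= T -> is_derive s 1 h (dh s).
  move=> sT; have n0 : T' - s != 0 by rewrite subr_eq0 gt_eqF // (le_lt_trans sT).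
  have D1 : is_derive s 1 (fun r : R => T' - r) (-1).
    by apply: is_derive_eq; rewrite /GRing.scale /=; ring.
  have D2 := @is_deriveV _ (fun r : R => T' - r) _ _ _ n0 D1.
  apply: is_derive_eq; rewrite /dh /GRing.scale /=; ring.
have pA : pos_def (h t *: Lam - X t).
  apply: (riccati_upper (h := h) (dh := dh) cX pX) => //; last exact: ltW.
  - by move=> s sT; apply: Dh; exact: ltW.
  - by apply: cvg_at_left_filter; apply: is_derive1_continuous; exact: Dh.
  - move=> s sT; rewrite /h /dh -exprVn.
    have y0 : 0 < (T' - s)^-1 by rewrite invr_gt0 subr_gt0 (lt_trans sT).
    by move: y0 ad0; set y := _^-1; set c := alpha * d; nra.
  - split; first exact: sym_mxB (sym_mxZ _ Lam_pos.1) pT.1.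
    move=> x x0; rewrite qformB qformZ subr_gt0.
    apply: (le_lt_trans (MX x)).
    have -> : h T = alpha * d + K + 2 by rewrite /h /T' [T + _]addrC addrK invrK; ring.
    have L0 := Lam_pos.2 _ x0.
    have : K * (m * qform 1%:M x) <= K * qform Lam x by rewrite ler_pM2l.
    have -> : K * (m * qform 1%:M x) = M * qform 1%:M x.
      by rewrite /K; field; rewrite gt_eqF.
    by move=> /le_lt_trans; apply; rewrite ltr_pM2r //; lra.
have := (pos_def_nonneg pA).2 v; rewrite qformB qformZ subr_ge0 => /le_trans; apply.
rewrite ler_wpM2r ?(pos_def_nonneg Lam_pos).2 // lerD2l.
rewrite lef_pV2 ?posrE ?subr_gt0 // ?(lt_trans tT) //.
by rewrite lerD2r ltW.
Qed.

End Riccati.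

(** * The limit of the solutions *)

Section LimitHelpers.
Variable R : realType.

(** The slope [D] serves two uses: 0 for the Lipschitz bound, and the expected derivative when the
    equation passes to the limit. Either order of [x] and [y] is allowed, to cover increments of
    both signs. *)
Lemma mean_value_le (f df : R -> R) (x y D e : R) :
  (forall s : R, Num.min x y <= s <= Num.max x y -> is_derive s 1 f (df s)) ->
  (forall s : R, Num.min x y <= s <= Num.max x y -> `|df s - D| <= e) ->
  `|f y - f x - D * (y - x)| <= e * `|y - x|.
Proof.
wlog xy : x y / x < y => [wl|] Df le_df.
  have [xy|yx|->] := ltgtP x y; first exact: wl.
    rewrite -normrN [`|y - x|]distrC.
    have -> : - (f y - f x - D * (y - x)) = f x - f y - D * (x - y) by ring.
    by apply: wl => // s sxy; [apply: Df | apply: le_df]; rewrite minC maxC.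
  by rewrite !subrr mulr0 subrr !normr0 mulr0.
rewrite (min_l (ltW xy)) (max_r (ltW xy)) in Df le_df.
have [||c cxy ->] := @MVT R f df x y xy.
- by move=> s; rewrite in_itv /= => /andP[a b]; apply: Df; rewrite !ltW.
- apply: derivable_within_continuous => s; rewrite in_itv /= => /Df[]//.
rewrite -mulrBl normrM ler_wpM2r // le_df //.
by move: cxy; rewrite in_itv /= => /andP[a b]; rewrite !ltW.
Qed.

(** Freezing [f] below [L + 1] makes it monotone on the whole line and keeps its limit at
    infinity. *)
Lemma monotone_bounded_cvg (f : R -> R) (L B : R) :
  (forall x y, L < x -> x <= y -> f x <= f y) -> (forall x, L < x -> f x <= B) ->
  exists l : R, f x @[x --> +oo] --> l /\ forall x, L < x -> f x <= l.
Proof.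
move=> fm fB; pose g x := f (Num.max x (L + 1)).
have gL x : L < Num.max x (L + 1) by rewrite lt_max ltrDl ltr01 orbT.
have [l gl] : exists l : R, g x @[x --> +oo] --> l.
  exists (sup (range g)); apply: nondecreasing_cvgr.
    by move=> x y xy; apply: fm => //; rewrite ge_max !le_max lexx xy orbT.
  by exists B => _ [x _ <-]; exact: fB.
have fl : f x @[x --> +oo] --> l.
  apply: cvg_trans gl; apply: near_eq_cvg; near=> x.
  rewrite /g max_l //; near: x; exact: nbhs_pinfty_ge (num_real _).
exists l; split => // x Lx; apply: (cvgr_to_ge fl); near=> y.
by apply: fm => //; near: y; exact: nbhs_pinfty_ge (num_real _).
Unshelve. all: by end_near. Qed.

(** The form at each fixed vector is nondecreasing and bounded; polarization at [e_i + e_j], [e_i]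
    and [e_j] recovers the entries. *)
Lemma monotone_bounded_cvg_mx n (M : R -> 'M[R]_n) (B : 'M[R]_n) (L : R) :
  (forall x, L < x -> sym_mx (M x)) ->
  (forall x y, L < x -> x <= y -> loewner_le (M x) (M y)) ->
  (forall x v, L < x -> qform (M x) v <= qform B v) ->
  exists A : 'M[R]_n, forall i j, M x i j @[x --> +oo] --> A i j.
Proof.
move=> sM mM bM.
have qM v : exists l : R, qform (M x) v @[x --> +oo] --> l.
  have [||l [lM _]] := @monotone_bounded_cvg (fun x => qform (M x) v) L (qform B v).
  - by move=> x y Lx xy; have := (mM x y Lx xy).2 v; rewrite qformB subr_ge0.
  - by move=> x Lx; exact: bM.
  by exists l.
have [q qP] := choice qM.
pose e k : 'rV[R]_n := delta_mx 0 k.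
exists (\matrix_(i, j) ((q (e i + e j) - q (e i) - q (e j)) / 2)) => i j; rewrite mxE.
have : (qform (M x) (e i + e j) - qform (M x) (e i) - qform (M x) (e j)) / 2
    @[x --> +oo] --> (q (e i + e j) - q (e i) - q (e j)) / 2.
  by apply: cvgM; [apply: cvgB; [apply: cvgB|]; exact: qP | exact: cvg_cst].
apply: cvg_trans; apply: near_eq_cvg; near=> x.
rewrite qform_addvec; last by apply: sM; near: x; exact: nbhs_pinfty_gt (num_real _).
by rewrite bform_delta; field.
Unshelve. all: by end_near. Qed.

End LimitHelpers.

(** * The family [X l] of solutions and its limit as [l] tends to infinity *)

Section RiccatiLimit.
Variables (R : realType) (n : nat) (Lam Sig : 'M[R]_n) (alpha : R) (theta : 'I_n -> R).
Hypotheses (n_gt0 : (0 < n)%N) (alpha_ge0 : 0 <= alpha) (Lam_pos : pos_def Lam)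
  (Sig_ge0 : nonneg_def Sig) (theta_ge0 : forall i, 0 <= theta i).

Local Notation F := (riccati_rhs Lam Sig alpha theta).
Local Notation riccati_curve := (riccati_curve Lam Sig alpha theta).

Lemma riccati_rhsE C i j : F C i j =
  \sum_l (\sum_k C k i * invmx Lam k l) * C l j
  + \sum_k C k i * (theta k / C k k) * C k j - alpha * Sig i j.
Proof.
have addE (M N : 'M[R]_n) : (M + N) i j = M i j + N i j by rewrite mxE.
have oppE a (M : 'M[R]_n) : (- (a *: M)) i j = - (a * M i j) by rewrite !mxE.
rewrite /riccati_rhs !addE oppE; congr (_ + _ - _).
  rewrite mxE; apply: eq_bigr => l _; rewrite mxE; congr (_ * _).
  by apply: eq_bigr => k _; rewrite mxE.
by rewrite mul_mx_diag mxE; apply: eq_bigr => k _; rewrite !mxE.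
Qed.

Lemma cvg_riccati_rhs (X : Type) (G : set_system X) {FG : Filter G}
    (M : X -> 'M[R]_n) (A : 'M[R]_n) i j :
  (forall k, A k k != 0) -> (forall k l, M x k l @[x --> G] --> A k l) ->
  F (M x) i j @[x --> G] --> F A i j.
Proof.
move=> A0 MA; under eq_cvg do rewrite riccati_rhsE; rewrite riccati_rhsE.
apply: cvgB; last exact: cvg_cst.
apply: cvgD; apply: cvg_sumr => k.
  by apply: cvgM => //; apply: cvg_sumr => l; apply: cvgM => //; exact: cvg_cst.
apply: cvgM => //; apply: cvgM => //; apply: cvgM; first exact: cvg_cst.
exact: cvgV.
Qed.

(** The delicate terms are [theta_k c_ki c_kj / c_kk]: by Cauchy-Schwarz [c_ki^2 <= B c_kk], which
    absorbs the denominator even when it is small. *)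
Lemma riccati_rhs_bound (B : R) : 0 <= B -> exists2 K, 0 <= K &
  forall C, nonneg_def C -> (forall k, C k k <= B) -> forall i j, `|F C i j| <= K.
Proof.
move=> B0; pose s := \sum_l \sum_k `|invmx Lam k l|.
pose th := \sum_i theta i; pose S := \sum_i \sum_j `|Sig i j|.
have s0 : 0 <= s by do 2![apply: sumr_ge0 => ? _].
have S0 : 0 <= S by do 2![apply: sumr_ge0 => ? _].
have th0 : 0 <= th by exact: sumr_ge0.
exists (B * s * B + th * B + alpha * S); first by rewrite !addr_ge0 ?mulr_ge0.
move=> C pC CB i j.
have CBn k l : `|C k l| <= B.
  by have := nonneg_def_entry_le k l pC; have := CB k; have := CB l; lra.
rewrite riccati_rhsE (le_trans (ler_normB _ _)) // lerD //; last first.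
  rewrite normrM ger0_norm // ler_wpM2l // /S (bigD1 i) //= (bigD1 j) //=.
  by rewrite -addrA lerDl addr_ge0 // ?sumr_ge0 // => ? _; rewrite sumr_ge0.
rewrite (le_trans (ler_normD _ _)) // lerD //.
  rewrite (le_trans (ler_norm_sum _ _ _)) // /s mulr_sumr mulr_suml ler_sum // => l _.
  rewrite normrM ler_pM // (le_trans (ler_norm_sum _ _ _)) // mulr_sumr ler_sum // => k _.
  by rewrite normrM ler_wpM2r.
rewrite (le_trans (ler_norm_sum _ _ _)) // /th mulr_suml ler_sum // => k _.
have c0 : 0 <= C k k by rewrite -qform_delta pC.2.
have -> : C k i * (theta k / C k k) * C k j = theta k * (C k i * C k j / C k k) by ring.
rewrite normrM ger0_norm // ler_wpM2l //.
have [ck|ck] := eqVneq (C k k) 0; first by rewrite ck invr0 mulr0 normr0.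
have {}c0 : 0 < C k k by rewrite lt_def ck.
rewrite normrM [`|_^-1|]gtr0_norm ?invr_gt0 // ler_pdivrMr //.
have cs m : C k m ^+ 2 <= B * C k k.
  have := bform_sqr_le (delta_mx 0 k) (delta_mx 0 m) pC.
  rewrite bform_delta !qform_delta => /le_trans; apply.
  by rewrite mulrC ler_pM2r.
have := cs i; have := cs j.
have := sqr_ge0 (C k i - C k j); have := sqr_ge0 (C k i + C k j).
by rewrite ler_norml => *; apply/andP; split; nra.
Qed.

(** The equation is autonomous. A delay [sg > 0] moves the end value to a time before [T], where
    differentiability gives continuity. *)
Lemma riccati_curve_shift T X (sg : R) : 0 < sg -> riccati_curve T X ->
  riccati_curve T (fun s => X (s - sg)).
Proof.
move=> sg0 [sX DX _].
have D (t : R) i j : t - sg < T ->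
    is_derive t 1 (fun s => X (s - sg) i j) (F (X (t - sg)) i j).
  move=> tT; have D1 : is_derive t 1 (fun s : R => s - sg) 1.
    by apply: is_derive_eq; rewrite /GRing.scale /=; ring.
  have := @is_derive1_comp _ (fun s => X s i j) (fun s : R => s - sg) _ _ _ (DX _ tT i j) D1.
  by rewrite mulr1.
split => [t tT|t tT i j|i j].
- by apply: sX; lra.
- by apply: D; lra.
- apply: cvg_at_left_filter; apply: is_derive1_continuous.
  by apply: D; lra.
Qed.

Variables (T d l0 : R) (X : R -> R -> 'M[R]_n).
Hypotheses (d_ge0 : 0 <= d) (Sig_le : forall v, qform Sig v <= d * qform Lam v)
  (l0_ge0 : 0 <= l0)
  (X_curve : forall l, l0 < l -> riccati_curve T (X l))
  (X_end : forall l, l0 < l -> X l T = l%:M).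

Lemma family_end_pos_def l : l0 < l -> pos_def (X l T).
Proof.
move=> ll; rewrite X_end //; split => [|v v0]; first exact: sym_mx_scalar.
by rewrite qform_scalar mulr_gt0 ?qform1_gt0 // (le_lt_trans l0_ge0).
Qed.

Lemma family_pos_def l t : l0 < l -> t <= T -> pos_def (X l t).
Proof.
move=> ll; exact: (riccati_curve_pos n_gt0 alpha_ge0 Lam_pos Sig_ge0 theta_ge0
  (X_curve ll) (family_end_pos_def ll)).
Qed.

Lemma family_nondecreasing l l' t : l0 < l -> l <= l' -> t <= T -> loewner_le (X l t) (X l' t).
Proof.
move=> ll l12; have ll' := lt_le_trans ll l12.
apply: (riccati_comparison n_gt0 alpha_ge0 Lam_pos Sig_ge0 theta_ge0 (X_curve ll) (X_curve ll')).
  exact: family_end_pos_def.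
rewrite !X_end //; split => [|v]; first by apply: sym_mxB; exact: sym_mx_scalar.
by rewrite qform_scalarB mulr_ge0 ?qform1_ge0 // subr_ge0.
Qed.

Let bnd t := alpha * d + 1 + (T - t)^-1.

Lemma family_blowup_bound l t v : l0 < l -> t < T -> qform (X l t) v <= bnd t * qform Lam v.
Proof.
move=> ll; apply: (riccati_blowup_bound n_gt0 alpha_ge0 Lam_pos Sig_ge0 theta_ge0 (X_curve ll)) => //.
exact: family_end_pos_def.
Qed.

(** Up to time [b] the blow-up bound controls the diagonals independently of [l], hence also the
    derivatives; one [K] serves all [l]. *)
Lemma family_lipschitz (b : R) : b < T -> exists2 K, 0 <= K &
  forall l s t i j, l0 < l -> s <= b -> t <= b ->
    `|X l s i j - X l t i j| <= K * `|s - t|.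
Proof.
move=> bT; have L0 k : 0 <= Lam k k.
  by rewrite -qform_delta; exact: (pos_def_nonneg Lam_pos).2.
have bnd0 : 0 <= bnd b by rewrite /bnd !addr_ge0 ?mulr_ge0 // invr_ge0 subr_ge0 ltW.
pose B := bnd b * \sum_k Lam k k.
have B0 : 0 <= B by rewrite mulr_ge0 // sumr_ge0.
have [K K0 KP] := riccati_rhs_bound B0; exists K => // l s t i j ll sb tb.
have [_ DX _] := X_curve ll.
have mb r : Num.min t s <= r <= Num.max t s -> r <= b.
  by move=> /andP[_ /le_trans]; apply; rewrite ge_max tb.
have := @mean_value_le _ (fun r => X l r i j) (fun r => F (X l r) i j) t s 0 K.
rewrite mul0r subr0; apply => r /mb rb; first by apply: DX; exact: le_lt_trans bT.
have rT := le_lt_trans rb bT.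
rewrite subr0; apply: KP; first by apply: pos_def_nonneg; apply: family_pos_def => //; exact: ltW.
move=> k; rewrite -qform_delta (le_trans (family_blowup_bound _ ll rT)) // qform_delta.
apply: (@le_trans _ _ (bnd b * Lam k k)).
  rewrite ler_wpM2r // lerD2l lef_pV2 ?posrE ?subr_gt0 //; lra.
by rewrite ler_wpM2l // (bigD1 k) //= lerDl sumr_ge0.
Qed.

(* A solution starting from any [l' > l0] needs backward time at most
   [sg = (l / M - alpha d - 1)^-1] to get below [l I]; from there it is dominated
   by a time shift of [X l]. *)
Lemma family_le_shift (M : R) : 0 < M -> (forall v, qform Lam v <= M * qform 1%:M v) ->
  forall l l' t, l0 < l -> 0 < l / M - (alpha * d + 1) -> l0 < l' ->
    let sg := (l / M - (alpha * d + 1))^-1 in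
    t <= T - sg -> loewner_le (X l' t) (X l (t + sg)).
Proof.
move=> M0 LM l l' t ll w0 ll' sg tsg.
have sg0 : 0 < sg by rewrite invr_gt0.
have cS := riccati_curve_shift sg0 (X_curve ll').
have := riccati_comparison n_gt0 alpha_ge0 Lam_pos Sig_ge0 theta_ge0 cS (X_curve ll).
have -> : X l' t = X l' (t + sg - sg) by rewrite addrK.
move=> /(_ _ _ (t + sg)); apply; last by lra.
  by apply: family_pos_def => //; lra.
have TS : T - sg < T by lra.
rewrite X_end //; split.
  by apply: sym_mxB; [exact: sym_mx_scalar | exact: (family_pos_def ll' (ltW TS)).1].
move=> v; rewrite qformB qform_scalar subr_ge0 (le_trans (family_blowup_bound _ ll' TS)) //.
have -> : bnd (T - sg) = l / M by rewrite /bnd opprB addrCA subrr addr0 invrK addrC subrK.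
apply: (@le_trans _ _ (l / M * (M * qform 1%:M v))).
  by rewrite ler_wpM2l // divr_ge0 // ltW // (le_lt_trans l0_ge0).
by rewrite mulrA divfK // gt_eqF.
Qed.

Lemma family_limit_exists : exists C : R -> 'M[R]_n, forall t, t < T -> forall i j,
  X l t i j @[l --> +oo] --> C t i j.
Proof.
have /choice[C CP] t : exists A : 'M[R]_n, t < T -> forall i j, X l t i j @[l --> +oo] --> A i j.
  have [tT|tT] := ltP t T; last by exists 0.
  have [||| A AP] := @monotone_bounded_cvg_mx _ _ (fun l => X l t) (bnd t *: Lam) l0.
  - by move=> l ll; exact: (family_pos_def ll (ltW tT)).1.
  - by move=> l l' ll l12; exact: family_nondecreasing ll l12 (ltW tT).
  - by move=> l v ll; rewrite qformZ; exact: family_blowup_bound.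
  by exists A.
by exists C.
Qed.

Variable C : R -> 'M[R]_n.
Hypothesis C_lim : forall t, t < T -> forall i j, X l t i j @[l --> +oo] --> C t i j.

Lemma limit_sym t : t < T -> sym_mx (C t).
Proof.
move=> tT; apply/matrixP => i j; rewrite mxE.
have h : X l t i j @[l --> +oo] --> C t j i.
  apply: cvg_trans (@C_lim _ tT j i); apply: near_eq_cvg; near=> l.
  have ll : l0 < l by near: l; exact: nbhs_pinfty_gt (num_real _).
  by rewrite -[in RHS](family_pos_def ll (ltW tT)).1 mxE.
exact: cvg_unique h (@C_lim _ tT i j).
Unshelve. all: by end_near. Qed.

Lemma family_le_limit l t : l0 < l -> t < T -> loewner_le (X l t) (C t).
Proof.
move=> ll tT; split; first by apply: sym_mxB (limit_sym tT) (family_pos_def ll (ltW tT)).1.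
move=> v; rewrite qformB subr_ge0.
have lim : qform (X m t) v @[m --> +oo] --> qform (C t) v.
  by apply: cvg_qform => i j; exact: C_lim.
apply: (cvgr_to_ge lim); near=> l'.
have ll' : l <= l' by near: l'; exact: nbhs_pinfty_ge (num_real _).
by have := (family_nondecreasing ll ll' (ltW tT)).2 v; rewrite qformB subr_ge0.
Unshelve. all: by end_near. Qed.

(** [C t] dominates the positive definite [X (l0 + 1) t]. This makes the quotients [theta k / c_kk]
    pass to the limit. *)
Lemma limit_diag_neq0 t k : t < T -> C t k k != 0.
Proof.
move=> tT; have ll : l0 < l0 + 1 by lra.
have := (family_le_limit ll tT).2 (delta_mx 0 k); rewrite qformB !qform_delta subr_ge0.
have := (family_pos_def ll (ltW tT)).2 _ (delta_rV_neq0 _ k); rewrite qform_delta => a b.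
by rewrite gt_eqF // (lt_le_trans a).
Qed.

(** [X l t <= C t <= X l (t + sg)], the upper bound by letting [l'] tend to infinity in
    [family_le_shift]. The diagonal gap is thus at most [K * sg], uniformly in [t], and it controls
    the other entries because [C t - X l t] is nonnegative. *)
Lemma family_cvg_uniform (b e : R) : b < T -> 0 < e ->
  \forall l \near +oo, forall t, t <= b -> forall i j, `|X l t i j - C t i j| < e.
Proof.
move=> bT e0; pose b' := (b + T) / 2; have b'T : b' < T by rewrite /b'; lra.
have [K K0 KP] := family_lipschitz b'T.
have [/eigenvalue_qform[u u0 uL] LM] := eig_maxP n_gt0 Lam_pos.1.
set M := eig_max _ in uL LM.
have M0 : 0 < M by have := Lam_pos.2 _ u0; rewrite uL pmulr_lgt0 // qform1_gt0.
(* Any shift below [r] gives a diagonal gap below [e] and keeps the shifted time at or before [b'],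
   the midpoint of [b] and [T]. *)
pose r := Num.min (e / (K + 1)) ((T - b) / 2).
have r0 : 0 < r by rewrite lt_min !divr_gt0 //; lra.
have K1 : 0 < K + 1 by lra.
have rK : r * (K + 1) <= e by rewrite -ler_pdivlMr // ge_min lexx.
have rb : r <= (T - b) / 2 by rewrite ge_min lexx orbT.
near=> l => t tb i j.
have ll : l0 < l by near: l; exact: nbhs_pinfty_gt (num_real _).
have wr : r^-1 < l / M - (alpha * d + 1).
  rewrite ltrBrDr ltr_pdivlMr //; near: l; exact: nbhs_pinfty_gt (num_real _).
have w0 : 0 < l / M - (alpha * d + 1) by apply: lt_trans wr; rewrite invr_gt0.
pose sg := (l / M - (alpha * d + 1))^-1.
have sg0 : 0 < sg by rewrite invr_gt0.
have sgr : sg < r by rewrite -[r]invrK ltf_pV2 ?posrE // invr_gt0.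
have tT := le_lt_trans tb bT.
have tsg : t <= T - sg by lra.
have nn := family_le_limit ll tT.
have diag k : (C t - X l t) k k <= K * sg.
  have leC : C t k k <= X l (t + sg) k k.
    apply: (cvgr_to_le (@C_lim _ tT k k)); near=> l'.
    have ll' : l0 < l' by near: l'; exact: nbhs_pinfty_gt (num_real _).
    have := (family_le_shift M0 LM ll w0 ll' tsg).2 (delta_mx 0 k).
    by rewrite qformB !qform_delta subr_ge0.
  have tb' : t <= b' by rewrite /b'; lra.
  have tsb' : t + sg <= b' by rewrite /b'; lra.
  have := KP l (t + sg) t k k ll tsb' tb'.
  rewrite [t + sg - t]addrAC subrr add0r [`|sg|]gtr0_norm // ler_norml => /andP[_].
  by rewrite !mxE; lra.
have := nonneg_def_entry_le i j nn; have := diag i; have := diag j.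
rewrite -[X l t i j - _]opprB normrN.
have -> : C t i j - X l t i j = (C t - X l t) i j by rewrite !mxE.
by nra.
Unshelve. all: by end_near. Qed.

(** Convergence at the single time [t] combines with the Lipschitz bound common to all [l]. Joint
    convergence puts [F (X l s)] near [F (C t)] for all [s] near [t] and all large [l] at once. *)
Lemma family_cvg_joint t i j : t < T ->
  X p.1 p.2 i j @[p --> filter_prod +oo (nbhs t)] --> C t i j.
Proof.
move=> tT; apply/cvgrPdist_le => e e0; pose b := (t + T) / 2.
have bT : b < T by rewrite /b; lra.
have [K K0 KP] := family_lipschitz bT; have K1 : 0 < K + 1 by lra.
pose r := Num.min (e / 2 / (K + 1)) ((T - t) / 2).
have r0 : 0 < r by rewrite lt_min !divr_gt0 //; lra.
have rK : r * (K + 1) <= e / 2 by rewrite -ler_pdivlMr // ge_min lexx.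
have rb : r <= (T - t) / 2 by rewrite ge_min lexx orbT.
have e2 : 0 < e / 2 by lra.
exists ([set l | l0 < l /\ `|C t i j - X l t i j| <= e / 2], ball t r).
  split; last exact: nbhsx_ballx.
  near=> l; split; first by near: l; exact: nbhs_pinfty_gt (num_real _).
  by near: l; move/cvgrPdist_le: (@C_lim _ tT i j); apply.
move=> [l s] [/= [ll le1] ts]; move: ts; rewrite /ball /= ltr_norml => /andP[t1 t2].
have sb : s <= b by rewrite /b; lra.
have tb : t <= b by rewrite /b; lra.
have := KP l t s i j ll tb sb; have : `|t - s| <= r by rewrite ler_norml !ltW.
have -> : C t i j - X l s i j = (C t i j - X l t i j) + (X l t i j - X l s i j) by ring.
move=> le2 le3; apply: (le_trans (ler_normD _ _)); move: le1 le2 le3; nra.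
Unshelve. all: by end_near. Qed.

(** The mean value inequality with slope [F (C t)] holds for every large [l] with the same error
    [e], so it survives the limit in [l] at fixed [h]; then divide by [|h|]. *)
Lemma limit_derive (t : R) i j : t < T -> is_derive t 1 (fun s => C s i j) (F (C t) i j).
Proof.
move=> tT; apply/is_derive1_quotient/cvgrPdist_le => e e0.
have : F (X p.1 p.2) i j @[p --> filter_prod +oo (nbhs t)] --> F (C t) i j.
  apply: cvg_riccati_rhs => [k|k m]; first exact: limit_diag_neq0.
  exact: family_cvg_joint.
move=> /cvgrPdist_le /(_ _ e0)[[A B] /= [Aoo /nbhs_ballP[r /= r0 Br]] AB].
rewrite near_withinE; apply/nbhs_ballP; pose r' := Num.min r (T - t).
have r'0 : 0 < r' by rewrite lt_min r0 subr_gt0.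
have r'r : r' <= r by rewrite ge_min lexx.
have r'T : r' <= T - t by rewrite ge_min lexx orbT.
exists r' => //= h; rewrite /ball /= sub0r normrN ltr_norml => /andP[h1 h2] hn0.
have thT : t + h < T by lra.
have lim : `|X l (t + h) i j - X l t i j - F (C t) i j * (t + h - t)| @[l --> +oo] -->
    `|C (t + h) i j - C t i j - F (C t) i j * (t + h - t)|.
  apply: cvg_norm; apply: cvgB; last exact: cvg_cst.
  by apply: cvgB; exact: C_lim.
have : `|C (t + h) i j - C t i j - F (C t) i j * (t + h - t)| <= e * `|t + h - t|.
  apply: (cvgr_to_le lim); near=> l.
  have ll : l0 < l by near: l; exact: nbhs_pinfty_gt (num_real _).
  have Al : A l by near: l.
  have sP s : Num.min t (t + h) <= s <= Num.max t (t + h) -> ball t r s /\ s < T.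
    rewrite ge_min le_max => /andP[/orP s1 /orP s2]; split; last by case: s2; lra.
    by rewrite /ball /= ltr_norml; apply/andP; split; case: s1; case: s2; lra.
  have [_ DX _] := X_curve ll.
  apply: (@mean_value_le _ (fun s => X l s i j) (fun s => F (X l s) i j)) => s /sP[bs sT].
    exact: DX.
  by rewrite distrC; apply: (AB (l, s)); split => //=; exact: Br.
rewrite [t + h - t]addrAC subrr add0r => le_e.
have -> : F (C t) i j - h^-1 * (C (t + h) i j - C t i j) =
    - (h^-1 * (C (t + h) i j - C t i j - F (C t) i j * h)).
  by field.
rewrite normrN normrM normfV mulrC ler_pdivrMr ?normr_gt0 //.
Unshelve. all: by end_near. Qed.

(** One index per level [A] suffices: for [l > A] the matrix [X l T = l I] exceeds [A I], left
    continuity preserves this near [T], and [C s] dominates [X l s]. *)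
Lemma limit_eig_min_cvg : eig_min (C s) @[s --> T^'-] --> +oo.
Proof.
apply/cvgryPge => A; pose l := Num.max (l0 + 1) (A + 1).
have ll : l0 < l by rewrite lt_max; apply/orP; left; lra.
have lA : A < l by rewrite lt_max; apply/orP; right; lra.
have [sX DX cX] := X_curve ll.
have pM : pos_def (X l T - A%:M).
  rewrite X_end //; split; first by apply: sym_mxB; exact: sym_mx_scalar.
  by move=> v v0; rewrite qform_scalarB mulr_gt0 ?qform1_gt0 // subr_gt0.
have XA i j : (X l s - A%:M) i j @[s --> T^'-] --> (X l T - A%:M) i j.
  under eq_cvg do rewrite mxE; rewrite mxE; apply: cvgD; [exact: cX | exact: cvg_cst].
have pd : \forall s \near T^'-, forall v, v != 0 -> 0 < qform (X l s - A%:M) v.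
  exact: near_pos_def n_gt0 pM XA.
near=> s.
have sT : s < T by near: s; exact: nbhs_left_lt.
apply: eig_min_ge => //; first exact: limit_sym.
move=> v; have [->|v0] := eqVneq v 0; first by rewrite !qform0 mulr0.
have : 0 < qform (X l s - A%:M) v by move: v v0; near: s; exact: pd.
have := (family_le_limit ll sT).2 v; rewrite !qformB qform_scalar; lra.
Unshelve. all: by end_near. Qed.

End RiccatiLimit.

(** * Scalar bounds *)

Section ScalarComparison.
Variables (R : realType) (n : nat) (Lam Sig : 'M[R]_n) (alpha : R) (theta : 'I_n -> R).
Hypotheses (n_gt0 : (0 < n)%N) (alpha_ge0 : 0 <= alpha) (Lam_pos : pos_def Lam)
  (Sig_ge0 : nonneg_def Sig) (theta_ge0 : forall i, 0 <= theta i).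
Variables (T : R) (X : R -> 'M[R]_n).
Hypotheses (X_curve : riccati_curve Lam Sig alpha theta T X) (XT_pos : pos_def (X T)).
Let th := \sum_i theta i.

(** [u] solves its equation exactly, so the strict comparison is applied to [(1 - z) u], which gains
    the margin [(1 - z) z u^2 + z alpha d]. *)
Lemma riccati_scalar_lower (u : R -> R) (d : R) :
  (forall t : R, t < T -> is_derive t 1 u (u t ^+ 2 + th * u t - alpha * d)) ->
  u s @[s --> T^'-] --> u T -> (forall t, t <= T -> 0 < u t) -> 0 <= d ->
  (forall v, d * qform Lam v <= qform Sig v) ->
  (forall v, u T * qform Lam v <= qform (X T) v) ->
  forall t v, t <= T -> u t * qform Lam v <= qform (X t) v.
Proof.
move=> Du cu u0 d0 dS uT t v tT.
have [->|v0] := eqVneq v 0; first by rewrite !qform0 mulr0.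
have L0 := Lam_pos.2 _ v0; have ut := u0 _ tT.
have ad0 : 0 <= alpha * d by rewrite mulr_ge0.
apply/ler_addgt0Pr => e e0.
(* This [z] lies strictly between 0 and 1 and makes the loss [z * u t * qform Lam v] at most [e]. *)
pose z := e / (u t * qform Lam v + e).
have m0 : 0 < u t * qform Lam v by exact: mulr_gt0.
have z0 : 0 < z by rewrite divr_gt0 // addr_gt0.
have z1 : z < 1 by rewrite ltr_pdivrMr ?addr_gt0 // mul1r ltrDr.
have := @riccati_lower _ _ _ _ _ _ n_gt0 alpha_ge0 Lam_pos theta_ge0 T X
  (fun s => (1 - z) * u s)
  (fun s => (1 - z) * (u s ^+ 2 + th * u s - alpha * d)) d X_curve.
move=> H; have /(_ t tT) pd : forall t, t <= T -> pos_def (X t - ((1 - z) * u t) *: Lam).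
  apply: H => //.
  - by move=> s sT; apply: is_deriveZ; exact: Du.
  - by apply: cvgM => //; exact: cvg_cst.
  - by move=> s sT; rewrite mulr_gt0 ?u0 // subr_gt0.
  - move=> s sT; have us := u0 _ (ltW sT); rewrite -/th.
    have : 0 < (1 - z) * z * u s ^+ 2 by rewrite mulr_gt0 ?exprn_gt0 // mulr_gt0 // subr_gt0.
    have : 0 <= z * (alpha * d) by rewrite mulr_ge0 // ltW.
    by nra.
  - split; first exact: sym_mxB XT_pos.1 (sym_mxZ _ Lam_pos.1).
    move=> w w0; rewrite qformB qformZ subr_gt0 (lt_le_trans _ (uT w)) //.
    rewrite ltr_pM2r; last exact: Lam_pos.2.
    by have := u0 _ (lexx T); nra.
have := pd.2 _ v0; rewrite qformB qformZ.
have : z * (u t * qform Lam v) <= e.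
  rewrite /z mulrAC ler_pdivrMr ?addr_gt0 // ler_pM2l // lerDl ltW //.
by nra.
Qed.

(** The same device with [(1 + z) u] and margin [(1 + z) z u^2 + z alpha d]. *)
Lemma riccati_scalar_upper (u : R -> R) (d : R) :
  (forall t : R, t < T -> is_derive t 1 u (u t ^+ 2 - alpha * d)) ->
  u s @[s --> T^'-] --> u T -> (forall t, t <= T -> 0 < u t) -> 0 <= d ->
  (forall v, qform Sig v <= d * qform Lam v) ->
  (forall v, qform (X T) v <= u T * qform Lam v) ->
  forall t v, t <= T -> qform (X t) v <= u t * qform Lam v.
Proof.
move=> Du cu u0 d0 dS uT t v tT.
have [->|v0] := eqVneq v 0; first by rewrite !qform0 mulr0.
have L0 := Lam_pos.2 _ v0; have ut := u0 _ tT.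
have ad0 : 0 <= alpha * d by rewrite mulr_ge0.
apply/ler_addgt0Pr => e e0.
have m0 : 0 < u t * qform Lam v by exact: mulr_gt0.
pose z := e / (u t * qform Lam v); have z0 : 0 < z by rewrite divr_gt0.
have pX := riccati_curve_pos n_gt0 alpha_ge0 Lam_pos Sig_ge0 theta_ge0 X_curve XT_pos.
have /(_ t tT) pd : forall t, t <= T -> pos_def (((1 + z) * u t) *: Lam - X t).
  apply: (@riccati_upper _ _ _ _ _ _ n_gt0 alpha_ge0 Lam_pos theta_ge0 T X
    (fun s => (1 + z) * u s) (fun s => (1 + z) * (u s ^+ 2 - alpha * d)) d X_curve pX) => //.
  - by move=> s sT; apply: is_deriveZ; exact: Du.
  - by apply: cvgM => //; exact: cvg_cst.
  - move=> s sT; have us := u0 _ (ltW sT).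
    have : 0 < (1 + z) * z * u s ^+ 2 by rewrite mulr_gt0 ?exprn_gt0 // mulr_gt0 // addr_gt0.
    have : 0 <= z * (alpha * d) by rewrite mulr_ge0 // ltW.
    by nra.
  - split; first exact: sym_mxB (sym_mxZ _ Lam_pos.1) XT_pos.1.
    move=> w w0; rewrite qformB qformZ subr_gt0 (le_lt_trans (uT w)) //.
    rewrite ltr_pM2r; last exact: Lam_pos.2.
    by have := u0 _ (lexx T); nra.
have := pd.2 _ v0; rewrite qformB qformZ.
have : z * (u t * qform Lam v) = e by rewrite /z divfK // gt_eqF.
by nra.
Qed.

End ScalarComparison.

(** * Scalar Riccati equations as matrix equations of size one *)

Section ScalarRiccati.
Variable R : realType.

(** Taking [Lam = 1], [Sig = b], [alpha = 1] and [theta = a] makes the matrix comparison results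
    available for [p] and [q]. The term [u (a / u) u] equals [a u] also where [u = 0]. *)
Lemma scalar_riccati_curve (T a b : R) (u : R -> R) :
  (forall t : R, t < T -> is_derive t 1 u (u t ^+ 2 + a * u t - b)) ->
  u s @[s --> T^'-] --> u T ->
  riccati_curve (1%:M : 'M[R]_1) b%:M 1 (fun=> a) T (fun s => (u s)%:M).
Proof.
move=> Du cu; have E (i j : 'I_1) : (fun s => ((u s)%:M : 'M[R]_1) i j) = u.
  by apply/funext => s; rewrite (ord1 i) (ord1 j) mxE eqxx mulr1n.
split => [t _|t tT i j|i j]; first exact: sym_mx_scalar; last first.
  rewrite E; suff -> : ((u T)%:M : 'M[R]_1) i j = u T by [].
  by rewrite -[RHS](congr1 (@^~ T) (E i j)).
rewrite E riccati_rhsE !big_ord1 invmx1 (ord1 i) (ord1 j) !mxE eqxx !mulr1n mulr1 mul1r.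
suff -> : u t * (a / u t) * u t = a * u t by rewrite -expr2; exact: Du.
have [->|ut] := eqVneq (u t) 0; first by rewrite !mulr0.
by field.
Qed.

(** Positivity, monotonicity in [l] and the bound uniform in [l] are the size-one cases of the
    matrix results; [c] stands for [lmax] or [lmin]. *)
Lemma scalar_riccati_limit (T a b c l0 : R) (u : R -> R -> R) :
  0 <= a -> 0 <= b -> 0 < c -> 0 <= l0 ->
  (forall l t : R, l0 < l -> t < T ->
     is_derive t 1 (u l) (u l t ^+ 2 + a * u l t - b)) ->
  (forall l, l0 < l -> u l s @[s --> T^'-] --> u l T) ->
  (forall l, l0 < l -> u l T = l / c) ->
  (forall l t, l0 < l -> t <= T -> 0 < u l t) /\
  forall t, t < T -> exists Pt : R, u l t @[l --> +oo] --> Pt /\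
    forall l, l0 < l -> u l t <= Pt.
Proof.
move=> a0 b0 c0 l00 Du cu uT.
have cX l : l0 < l -> _ := fun ll => scalar_riccati_curve (fun t tT => Du l t ll tT) (cu l ll).
have bS : nonneg_def (b%:M : 'M[R]_1).
  split => [|v]; first exact: sym_mx_scalar.
  by rewrite qform_scalar mulr_ge0 // qform1_ge0.
have pT l : l0 < l -> pos_def ((u l T)%:M : 'M[R]_1).
  move=> ll; split => [|v v0]; first exact: sym_mx_scalar.
  by rewrite qform_scalar uT // mulr_gt0 ?qform1_gt0 // divr_gt0 // (le_lt_trans l00).
have q1 (x : R) : qform (x%:M : 'M[R]_1) (delta_mx 0 0) = x.
  by rewrite qform_delta mxE eqxx.
have th0 : forall i : 'I_1, 0 <= (fun=> a) i by [].
split.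
  move=> l t ll tT; rewrite -[u l t]q1.
  have := riccati_curve_pos (ltn0Sn 0) ler01 (pos_def1 R 1) bS th0 (cX l ll) (pT l ll) tT.
  by move=> pd; apply: pd.2; exact: delta_rV_neq0.
move=> t tT.
apply: (@monotone_bounded_cvg R (fun l => u l t) l0 (1 * b + 1 + (T - t)^-1)) => [l l' ll l12|l ll].
  have ll' := lt_le_trans ll l12.
  have := riccati_comparison (ltn0Sn 0) ler01 (pos_def1 R 1) bS th0 (cX l ll) (cX l' ll') (pT l ll).
  have le_end : loewner_le ((u l T)%:M : 'M[R]_1) (u l' T)%:M.
    split => [|v]; first by apply: sym_mxB; exact: sym_mx_scalar.
    by rewrite qform_scalarB mulr_ge0 ?qform1_ge0 // subr_ge0 !uT // ler_pM2r ?invr_gt0.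
  by move=> /(_ le_end t (ltW tT))[_ /(_ (delta_mx 0 0))]; rewrite qformB !q1 subr_ge0.
have := @riccati_blowup_bound _ _ _ _ _ _ (ltn0Sn 0) ler01 (pos_def1 R 1) bS th0 T _ b (cX l ll) (pT l ll) b0.
have bb (v : 'rV[R]_1) : qform b%:M v <= b * qform 1%:M v by rewrite qform_scalar.
by move=> /(_ bb t (delta_mx 0 0) tT); rewrite !q1 mulr1.
Qed.

End ScalarRiccati.

(** The substitution [w = v *m Lam *m S] turns the [Lam] form at [v] into the squared norm of [w],
    with [w *m S = v]. Eigenvalue bounds for [S Sig S] thereby become bounds of [Sig] by multiples
    of [Lam]. *)
Lemma sqrtm_inv_normalize (R : realType) (n : nat) (Lam : 'M[R]_n) : (0 < n)%N ->
  pos_def Lam -> let S := sqrtm (invmx Lam) in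
  [/\ S^T = S, S *m Lam *m S = 1%:M & forall v, qform 1%:M (v *m Lam *m S) = qform Lam v
      /\ v *m Lam *m S *m S = v].
Proof.
move=> n0 pL; have uL := pos_def_unitmx pL.
have [[sS _] SS] := sqrtmP n0 (pos_def_nonneg (pos_def_inv pL)).
set S := sqrtm _ in sS SS *; split => // [|v].
  by apply: mulmx1C; rewrite mulmxA SS mulVmx.
split; last by rewrite -[LHS]mulmxA SS mulmxK.
by rewrite 2!qform_mul mulmx1 sS SS pL.1 mulmxV // mul1mx.
Qed.
Unset Implicit Arguments.

Theorem theorem3p6 (R : realType) (n : nat) (T alpha : R)
  (Lam Sig : 'M[R]_n) (theta : 'I_n -> R)
  (Cl : R -> R -> 'M[R]_n) (p q : R -> R -> R) :
  (0 < n)%N -> 0 < T -> 0 <= alpha ->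
  pos_def Lam -> nonneg_def Sig -> (forall i, 0 <= theta i) ->
  let th := \sum_i theta i in
  let S := sqrtm (invmx Lam) in
  let D := S *m Sig *m S in
  let dmin := eig_min D in let dmax := eig_max D in
  let lmin := eig_min Lam in let lmax := eig_max Lam in
  let l0 := Num.max (lmax * (Num.sqrt (th ^+ 2 / 4 + alpha * dmin) - th / 2))
                    (lmin * Num.sqrt (alpha * dmax)) in
  (* C(l,.) : the symmetric solution on (-oo,T] with C(l,T) = l I *)
  (forall l, l0 < l ->
     (forall t, t <= T -> sym_mx (Cl l t)) /\
     riccati_sol_on `]-oo, T] Lam Sig alpha theta (Cl l) /\
     Cl l T = l%:M) ->
  (* P(l,.) = p l . I : P' = P^2 + theta P - alpha dmin I, P(T) = l/lmax I *)
  (forall l, l0 < l ->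
     (forall t, t <= T ->
        deriv_within `]-oo, T] (p l) t (p l t ^+ 2 + th * p l t - alpha * dmin)) /\
     p l T = l / lmax) ->
  (* Q(l,.) = q l . I : Q' = Q^2 - alpha dmax I, Q(T) = l/lmin I *)
  (forall l, l0 < l ->
     (forall t, t <= T ->
        deriv_within `]-oo, T] (q l) t (q l t ^+ 2 - alpha * dmax)) /\
     q l T = l / lmin) ->
  exists C : R -> 'M[R]_n,
    (* (i) *)
    (forall t, 0 <= t < T -> forall i j,
       (fun l => Cl l t i j) @ +oo --> C t i j) /\
    (forall a b, 0 <= a -> b < T -> forall e, 0 < e ->
       \forall l \near +oo, forall t, a <= t <= b -> forall i j,
         `|Cl l t i j - C t i j| < e) /\
    ((fun l => eig_min (Cl l T)) @ +oo --> +oo) /\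
    (* (ii) *)
    riccati_sol_on `[0, T[ Lam Sig alpha theta C /\
    ((fun s => eig_min (C s)) @ at_left T --> +oo) /\
    (forall t, 0 <= t < T ->
       exists Pt Qt : R,
         ((fun l => p l t) @ +oo --> Pt) /\
         ((fun l => q l t) @ +oo --> Qt) /\
         0 < Pt /\
         loewner_le (Pt%:M) (S *m C t *m S) /\
         loewner_le (S *m C t *m S) (Qt%:M)).
Proof.
move=> n0 T0 al0 pL nS th0 th S D dmin dmax lmin lmax l0 solC solp solq.
have [sS SLS LS] := sqrtm_inv_normalize n0 pL; rewrite -/S in sS SLS LS.
have qD w : qform D w = qform Sig (w *m S) by rewrite qform_mul sS.
have sD : sym_mx D by rewrite /sym_mx /D !trmx_mul sS (nS.1 : Sig^T = Sig) mulmxA.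
have [edmin dminP] := eig_minP n0 sD; have [edmax dmaxP] := eig_maxP n0 sD.
have [elmin lminP] := eig_minP n0 pL.1; have [elmax lmaxP] := eig_maxP n0 pL.1.
rewrite -/dmin in edmin dminP; rewrite -/dmax in edmax dmaxP.
rewrite -/lmin in elmin lminP; rewrite -/lmax in elmax lmaxP.
have d_ge0 e : eigenvalue D e -> 0 <= e.
  move=> /eigenvalue_qform[v v0 vD]; have := nS.2 (v *m S).
  by rewrite -qD vD pmulr_lge0 // qform1_gt0.
have l_gt0 e : eigenvalue Lam e -> 0 < e.
  move=> /eigenvalue_qform[v v0 vL]; have := pL.2 _ v0.
  by rewrite vL pmulr_lgt0 // qform1_gt0.
have dmin0 := d_ge0 _ edmin; have dmax0 := d_ge0 _ edmax.
have lmin0 := l_gt0 _ elmin; have lmax0 := l_gt0 _ elmax.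
(* The second term of the maximum is nonnegative, so every [l > l0] is positive. *)
have l00 : 0 <= l0.
  by rewrite le_max; apply/orP; right; rewrite mulr_ge0 ?sqrtr_ge0 // ltW.
have thge0 : 0 <= th by exact: sumr_ge0.
have dminS v : dmin * qform Lam v <= qform Sig v.
  by have [<- {2}<-] := LS v; rewrite -qD.
have dmaxS v : qform Sig v <= dmax * qform Lam v.
  by have [<- {1}<-] := LS v; rewrite -qD.
have nbhsT (t : R) : t < T -> nbhs t [set` `]-oo, T]].
  move=> tT; near=> s; rewrite /= in_itv /= ltW //.
  by near: s; exact: lt_nbhsl.
have curveC l : l0 < l -> riccati_curve Lam Sig alpha theta T (Cl l).
  move=> ll; have [sC [dC _]] := solC l ll; split => // [t tT i j|i j].
    apply: deriv_within_interior (nbhsT _ tT) _.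
    by apply: dC; rewrite /= in_itv /= ltW.
  by apply: deriv_within_at_left; apply: dC; rewrite /= in_itv /=.
have endC l : l0 < l -> Cl l T = l%:M by move=> ll; have [_ []] := solC l ll.
have [C limC] := family_limit_exists n0 al0 pL nS th0 dmax0 dmaxS l00 curveC endC.
have Dp l (t : R) : l0 < l -> t < T ->
    is_derive t 1 (p l) (p l t ^+ 2 + th * p l t - alpha * dmin).
  move=> ll tT; have [dp _] := solp l ll.
  by apply: deriv_within_interior (nbhsT _ tT) _; apply: dp; exact: ltW.
have Dq l (t : R) : l0 < l -> t < T -> is_derive t 1 (q l) (q l t ^+ 2 - alpha * dmax).
  move=> ll tT; have [dq _] := solq l ll.
  by apply: deriv_within_interior (nbhsT _ tT) _; apply: dq; exact: ltW.
have cp l : l0 < l -> p l s @[s --> T^'-] --> p l T.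
  by move=> ll; have [dp _] := solp l ll; apply: deriv_within_at_left (dp T _).
have cq l : l0 < l -> q l s @[s --> T^'-] --> q l T.
  by move=> ll; have [dq _] := solq l ll; apply: deriv_within_at_left (dq T _).
have [p_gt0 limp] := scalar_riccati_limit thge0 (mulr_ge0 al0 dmin0) lmax0 l00 Dp cp
  (fun l ll => (solp l ll).2).
have Dq' l (t : R) : l0 < l -> t < T ->
    is_derive t 1 (q l) (q l t ^+ 2 + 0 * q l t - alpha * dmax).
  by move=> ll tT; rewrite mul0r addr0; exact: Dq.
have [q_gt0 limq] := scalar_riccati_limit (lexx 0) (mulr_ge0 al0 dmax0) lmin0 l00 Dq' cq
  (fun l ll => (solq l ll).2).
have CT_pos l : l0 < l -> pos_def (Cl l T) 
  by move=> ll; exact: (family_pos_def n0 al0 pL nS th0 l00 curveC endC ll (lexx T)).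
have lowC l t v : l0 < l -> t <= T -> p l t * qform Lam v <= qform (Cl l t) v.
  move=> ll; apply: (riccati_scalar_lower n0 al0 pL th0 (curveC l ll) (CT_pos l ll)
    (fun t => Dp l t ll) (cp l ll) (fun t => p_gt0 l t ll) dmin0 dminS) => w.
  (* At [T] this is [(l / lmax) Lam <= l I], the Rayleigh bound for [Lam]. *)
  rewrite (solp l ll).2 endC // qform_scalar mulrAC ler_pdivrMr // -mulrA ler_pM2l ?(le_lt_trans l00) //.
  by rewrite mulrC lmaxP.
have upC l t v : l0 < l -> t <= T -> qform (Cl l t) v <= q l t * qform Lam v.
  move=> ll; apply: (riccati_scalar_upper n0 al0 pL nS th0 (curveC l ll) (CT_pos l ll)
    (fun t => Dq l t ll) (cq l ll) (fun t => q_gt0 l t ll) dmax0 dmaxS) => w.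
  rewrite (solq l ll).2 endC // qform_scalar mulrAC ler_pdivlMr // -mulrA ler_pM2l ?(le_lt_trans l00) //.
  by rewrite mulrC lminP.
exists C; split; [|split; [|split; [|split; [|split]]]].
- by move=> t /andP[_ tT] i j; exact: limC.
- move=> a b _ bT e e0.
  have := family_cvg_uniform n0 al0 pL nS th0 dmax0 dmaxS l00 curveC endC limC bT e0.
  by apply: filterS => l H t /andP[_ tb] i j; exact: H.
- apply/cvgryPge => A; near=> l.
  have ll : l0 < l by near: l; exact: nbhs_pinfty_gt (num_real _).
  rewrite endC //; apply: (@le_trans _ _ l).
    by near: l; exact: nbhs_pinfty_ge (num_real _).
  by apply: eig_min_ge => // [|v]; [exact: sym_mx_scalar | rewrite qform_scalar].
(* The limit exists on all of []-oo, T[], so even at 0 the derivative is two-sided, and it restricts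
   to [[0, T[]. *)
- move=> t; rewrite /= in_itv /= => /andP[_ tT] i j; apply: is_derive_deriv_within.
  exact: (limit_derive n0 al0 pL nS th0 dmax0 dmaxS l00 curveC endC limC).
- exact: (limit_eig_min_cvg n0 al0 pL nS th0 l00 curveC endC limC).
- move=> t /andP[_ tT].
  have [Pt [cPt lePt]] := limp t tT; have [Qt [cQt leQt]] := limq t tT.
  have ll1 : l0 < l0 + 1 by rewrite ltrDl.
  have sC := limit_sym n0 al0 pL nS th0 l00 curveC endC limC tT.
  have sSCS : sym_mx (S *m C t *m S) by rewrite /sym_mx !trmx_mul sS sC mulmxA.
  have qSCS w : qform (S *m C t *m S) w = qform (C t) (w *m S) by rewrite qform_mul sS.
  have q1E w : qform 1%:M w = qform Lam (w *m S) by rewrite qform_mul sS SLS.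
  exists Pt, Qt; split => //; split => //; split.
    (* The limit bounds every [p l t] from above, and a single admissible index gives a positive
       value. *)
    exact: lt_le_trans (p_gt0 _ _ ll1 (ltW tT)) (lePt _ ll1).
  (* Testing at [w] and setting [v = w S] reduces both inequalities to [Lam] bounds on [C t], the
     limits of [lowC] and [upC]. *)
  split; (split; first by apply: sym_mxB => //; exact: sym_mx_scalar);
    move=> w; rewrite qformB qform_scalar qSCS q1E subr_ge0; move: (w *m S) => v.
  + have limX : qform (Cl l t) v @[l --> +oo] --> qform (C t) v.
      by apply: cvg_qform => i j; exact: limC.
    have limP : p l t * qform Lam v @[l --> +oo] --> Pt * qform Lam v.
      by apply: cvgM => //; exact: cvg_cst.
    apply: (ler_cvg_to limP limX); near=> l; apply: lowC; last exact: ltW.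
    by near: l; exact: nbhs_pinfty_gt (num_real _).
  + have limX : qform (Cl l t) v @[l --> +oo] --> qform (C t) v.
      by apply: cvg_qform => i j; exact: limC.
    have limQ : q l t * qform Lam v @[l --> +oo] --> Qt * qform Lam v.
      by apply: cvgM => //; exact: cvg_cst.
    apply: (ler_cvg_to limX limQ); near=> l; apply: upC; last exact: ltW.
    by near: l; exact: nbhs_pinfty_gt (num_real _).
Unshelve. all: by end_near. Qed.
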